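(* There is an algorithm that, given any instance $(G,A,x_I,x_G)$ of Formation Control on Graphs with $n=|A|$ agents on a graph $G$ with $V$ vertices, computes in worst-case time $O(nV^2)$ a distance optimal solution $P=\{p_1,\dots,p_n\}$ whose convergence time is at most $n+\ell-1$, where $\ell=\max_{u\in x_I(A),\,v\in x_G(A)}\mathrm{dist}(u,v)$ and $\mathrm{dist}$ is the shortest-path distance in $G$.
   Context: $G$ is a finite connected undirected simple graph with vertex set $V$ and edge set $E$ (each edge has length 1; the symbol $V$ also denotes the number of vertices), $A=\{a_1,\dots,a_n\}$, $n\ge1$, is a set of agents, and $x_I,x_G:A\to V$ are injective maps (initial and goal vertices) with $x_I(A)\cap x_G(A)=\emptyset$. A scheduled path is a map $p_i:\{0,1,2,\dots\}\to V$. For a permutation $\sigma$ of the goals, write $\sigma\circ x_G$ for the resulting goal assignment. The path $p_i$ is feasible for $a_i$ (with respect to $\sigma$) if $p_i(0)=x_I(a_i)$, there is a smallest $k_{\min}$ with $p_i(k_{\min})=(\sigma\circ x_G)(a_i)$, $p_i(k)=(\sigma\circ x_G)(a_i)$ for all $k\ge k_{\min}$, and for $0\le k<k_{\min}$ either $(p_i(k),p_i(k+1))\in E$ or $p_i(k)=p_i(k+1)$. Two paths $p_i,p_j$ ($i\ne j$) are in collision if for some $k$ either $p_i(k)=p_j(k)$ or $(p_i(k),p_i(k+1))=(p_j(k+1),p_j(k))$. A solution of the instance of Formation Control on Graphs is a permutation $\sigma$ together with $P=\{p_1,\dots,p_n\}$, $p_i$ feasible for $a_i$ with respect to this common $\sigma$,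 no two paths being in collision. Its total distance is the total number of pairs $(i,k)$ with $p_i(k)\ne p_i(k+1)$; it is distance optimal if the total distance is minimum among all solutions. Its convergence time is the time at which the last agent reaches its goal (the maximum of $k_{\min}$ over the agents). Running time is counted in elementary operations in the standard (unit-cost RAM) model. *)

(* Defs.v *)
From mathcomp Require Import all_boot all_fingroup.

Set Implicit Arguments.
Unset Strict Implicit.
Unset Printing Implicit Defensive.

(** ** Formation Control on Graphs *)

Section FormationControl.
Variables (T : finType) (n : nat).

(* Agents are identified with the elements of 'I_n. *)
Implicit Types (e : rel T) (xI xG : 'I_n -> T) (s : {perm T}).
Implicit Types (p : nat -> T) (P : 'I_n -> nat -> T).

Record fcg_instance e xI xG : Prop := FcgInstance {
  fcg_sym : symmetric e;
  fcg_irrefl : irreflexive e;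
  fcg_connected : forall u v, connect e u v;
  fcg_agents : 0 < n;
  fcg_injI : injective xI;
  fcg_injG : injective xG;
  fcg_disjoint : forall i j, xI i != xG j
}.

(* Least number of edges of a walk from u to v.  A shortest walk repeats no
   vertex, so lengths below #|T| suffice; the value is #|T| when v is not
   reachable from u. *)
Definition dist e (u v : T) : nat :=
  find (fun k => [exists w : k.-tuple T, path e u w && (last u w == v)])
       (iota 0 #|T|).

Definition max_dist e xI xG : nat :=
  \max_(i < n) \max_(j < n) dist e (xI i) (xG j).

(* k is the smallest time at which p is at g. *)
Definition first_visit p (g : T) (k : nat) : Prop :=
  p k = g /\ forall j, j < k -> p j <> g.

Definition feasible e (start goal : T) p : Prop :=
  p 0 = start /\
  exists kmin, [/\ first_visit p goal kmin,
    forall k, kmin <= k -> p k = goal &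
    forall k, k < kmin -> e (p k) (p k.+1) \/ p k = p k.+1].

Definition collision p q : Prop :=
  exists k, p k = q k \/ (p k, p k.+1) = (q k.+1, q k).

(* s permutes the set of goal vertices: it maps this set onto itself and is
   the identity elsewhere. *)
Definition solution e xI xG s P : Prop :=
  [/\ perm_on [set xG i | i : 'I_n] s,
      forall i, feasible e (xI i) (s (xG i)) (P i) &
      forall i j, i != j -> ~ collision (P i) (P j)].

(* There are exactly D pairs (i, k) with P i k != P i k.+1; in particular
   there are finitely many, which holds for every solution. *)
Definition total_distance P (D : nat) : Prop :=
  exists r : seq ('I_n * nat), [/\ uniq r,
    forall i k, ((i, k) \in r) = (P i k != P i k.+1) & size r = D].

Definition distance_optimal e xI xG s P : Prop :=
  solution e xI xG s P /\
  exists2 D, total_distance P D &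
    forall s' P' D', solution e xI xG s' P' -> total_distance P' D' -> D <= D'.

(* c is the maximum over the agents of the first visit to the goal. *)
Definition convergence_time xG s P (c : nat) : Prop :=
  exists2 kmin : 'I_n -> nat,
    forall i, first_visit (P i) (s (xG i)) (kmin i) & c = \max_(i < n) kmin i.

End FormationControl.

(** ** Unit-cost random access machine

  A fixed finite program acts on registers, which instructions address
  directly, and on a memory addressed through the contents of registers.
  Registers and memory cells hold natural numbers; in the comments below a
  register number stands for the contents of that register.  The only arithmetic is
  addition and truncated subtraction, as unit-cost multiplication of unbounded
  numbers would make the model unreasonably powerful. *)

Inductive instr : Type :=
| Const (r c : nat)      (* r := c *)
| Move (r a : nat)       (* r := a *)
| Add (r a b : nat)      (* r := a + b *)
| Sub (r a b : nat)      (* r := a - b *)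
| Read (r a : nat)       (* r := mem[a] *)
| Write (a r : nat)      (* mem[a] := r *)
| Jump (l : nat)
| JumpLt (a b l : nat)   (* if a < b then goto l *)
| JumpEq (a b l : nat)   (* if a = b then goto l *)
| Halt.

Definition program := seq instr.

Record state : Type := State {
  pc : nat;
  reg : nat -> nat;
  memory : nat -> nat
}.

Definition fetch (prog : program) (st : state) : instr := nth Halt prog (pc st).

Definition step (prog : program) (st : state) : option state :=
  let: State pc reg mem := st in
  let set_reg r v := Some (State pc.+1 [eta reg with r |-> v] mem) in
  let goto_if (b : bool) l := Some (State (if b then l else pc.+1) reg mem) in
  match fetch prog st with
  | Const r c => set_reg r c
  | Move r a => set_reg r (reg a)
  | Add r a b => set_reg r (reg a + reg b)
  | Sub r a b => set_reg r (reg a - reg b)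
  | Read r a => set_reg r (mem (reg a))
  | Write a r => Some (State pc.+1 reg [eta mem with reg a |-> reg r])
  | Jump l => goto_if true l
  | JumpLt a b l => goto_if (reg a < reg b) l
  | JumpEq a b l => goto_if (reg a == reg b) l
  | Halt => None
  end.

(* [exec prog st t st']: started in st, prog executes exactly t instructions
   and then halts in st'. *)
Inductive exec (prog : program) : state -> nat -> state -> Prop :=
| ExecHalt st : step prog st = None -> exec prog st 0 st
| ExecStep st st1 t st2 :
    step prog st = Some st1 -> exec prog st1 t st2 -> exec prog st t.+1 st2.

(** ** Input and output conventions *)

Section Encoding.
Variables (V n : nat).
Implicit Types (e : rel 'I_V) (xI xG : 'I_n -> 'I_V).

(* Memory initially holds V, n, the adjacency matrix in row-major order, the
   initial vertices and the goal vertices, followed by zeros. *)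
Definition input_cells e xI xG : seq nat :=
  [:: V; n]
  ++ [seq (e u v : nat) | u <- enum 'I_V, v <- enum 'I_V]
  ++ [seq (xI i : nat) | i <- enum 'I_n]
  ++ [seq (xG i : nat) | i <- enum 'I_n].

Definition init_state e xI xG : state :=
  State 0 (fun=> 0) (nth 0 (input_cells e xI xG)).

(* On halting, register 0 points to a block holding a horizon h, then the goal
   s (xG i) assigned to each agent, then for each agent its h.+1 positions at
   times 0, ..., h; the agent stays at the last of these forever after. *)
Definition output_is xG (st : state) (s : {perm 'I_V}) (P : 'I_n -> nat -> 'I_V)
    : Prop :=
  let b := reg st 0 in
  let h := memory st b in
  (forall i : 'I_n, memory st (b + 1 + i) = s (xG i)) /\
  (forall (i : 'I_n) (k : nat),
     memory st (b + 1 + n + i * h.+1 + minn k h) = P i k).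

End Encoding.

(* Main.v *)
Require Import Defs.
From mathcomp Require Import all_boot all_fingroup zify.

Set Implicit Arguments.
Unset Strict Implicit.
Unset Printing Implicit Defensive.

(* Kantorovich duality on G.  The minimum total distance is attained by an integral
   flow from the starts to the goals supported on tight edges, phi u = phi v + 1, of a
   1-Lipschitz potential phi.  Flow and potential are found by n augmentations, each
   along a shortest residual path for the costs reduced by phi; one search takes
   O(V^2) steps.  Every solution costs at least
   sum phi (start) - sum phi (goal), and agents that only move along edges carrying
   flow attain this bound, whatever goals they end up in.

   The agents then move greedily: at each time step, in increasing order of phi, an
   agent crosses an edge carrying flow if the next vertex is free.  Put
   lam = phi (position) + time.  A move preserves lam, and a blocked agent sees its lam
   exceed by one that of its blocker, so the values of lam above the maximum M of phi
   on the starts form a gapless chain; hence lam < M + n, and an agent stopping at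
   a goal g does so by time M - phi g + n - 1 <= l + n - 1. *)

(** * A structured language over the machine *)

(** Since phi drops along every edge carrying flow, these edges form no cycle, so greedy moves can
    neither swap two agents nor deadlock. No agent owns a goal: one standing on a goal vertex that
    still has outgoing flow moves on, and only the balance of the remaining flow shows that the
    agents end on goals; where they end then defines the permutation. The order of increasing phi
    makes a blockage last until the end of the time step: edges carrying flow lead one level down,
    where every agent has already had its turn. Hence the blocker, whether it stayed or has just
    entered, has a lam smaller by exactly one. The budget allows V^2 steps per search, hence a plain
    scan for the nearest vertex, and n V steps for each of 2 V time steps, hence a scan of all
    agents on each of V levels instead of sorting. The program has counted loops only, so its
    running time is bounded from its syntax and the sizes; as the machine does not multiply,
    products come from repeated addition and tables. *)

Inductive expr :=
| Cst of nat
| Var of nat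
| Raw of expr
| Arr of nat & expr
| Plus of expr & expr
| Minus of expr & expr.

Inductive cmd :=
| Skip
| Assign of nat & expr
| Put of nat & expr & expr
| Out of expr & expr
| Seq of cmd & cmd
| IfLt of expr & expr & cmd & cmd
| For of nat & nat & cmd.

Record store := MkStore { var : nat -> nat; ram : nat -> nat }.

Definition rB := 1.
Definition tmp := 40.

Definition upd (f : nat -> nat) x v := fun y => if y == x then v else f y.

Arguments upd f x v y /.

(* Sixteen unbounded arrays are interleaved above the address kept in register
   rB; the cells below that address are the raw input and output area. *)
Definition cell s a i := i * 16 + a + var s rB.
Definition arr s a i := ram s (cell s a i).

Arguments cell : simpl never.
Arguments arr : simpl never.

Definition setv r v s := MkStore (upd (var s) r v) (ram s).
Definition put a i v s := MkStore (var s) (upd (ram s) (cell s a i) v).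
(* Writes outside the raw area are skipped, so that the arrays are never overwritten. *)
Definition out j v s :=
  if j < var s rB then MkStore (var s) (upd (ram s) j v) else s.

Fixpoint eval s e := match e with
| Cst c => c
| Var r => var s r
| Raw e => ram s (eval s e)
| Arr a e => arr s a (eval s e)
| Plus e1 e2 => eval s e1 + eval s e2
| Minus e1 e2 => eval s e1 - eval s e2
end.

Definition bump_run r (f : store -> store) s :=
  let s' := f s in setv r (var s' r).+1 s'.

Fixpoint run c s := match c with
| Skip => s
| Assign r e => setv r (eval s e) s
| Put a ei ev => put a (eval s ei) (eval s ev) s
| Out ei ev => out (eval s ei) (eval s ev) s
| Seq c1 c2 => run c2 (run c1 s)
| IfLt e1 e2 c1 c2 => if eval s e1 < eval s e2 then run c1 s else run c2 s
| For r lim c => iter (var s lim) (bump_run r (run c)) (setv r 0 s)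
end.

(** Four doublings multiply the index by 16, the number of interleaved arrays; register [t.+1] is
    scratch space. *)
Definition addr a t : seq instr :=
  [:: Add t t t; Add t t t; Add t t t; Add t t t; Const t.+1 a; Add t t t.+1;
      Add t t rB].

(** Registers from [t] on act as an evaluation stack: the result is left in [t], and registers below
    [t] survive. With [t] at least [tmp] no program variable is disturbed. *)
Fixpoint ecode e t : seq instr := match e with
| Cst c => [:: Const t c]
| Var r => [:: Move t r]
| Raw e => ecode e t ++ [:: Read t t]
| Arr a e => ecode e t ++ addr a t ++ [:: Read t t]
| Plus e1 e2 => ecode e1 t ++ ecode e2 t.+1 ++ [:: Add t t t.+1]
| Minus e1 e2 => ecode e1 t ++ ecode e2 t.+1 ++ [:: Defs.Sub t t t.+1]
end.

(** The length does not depend on the offset, so absolute jump targets can be computed before the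
    code is placed. *)
Fixpoint csize c := match c with
| Skip => 0
| Assign r e => size (ecode e tmp) + 1
| Put a ei ev => size (ecode ei tmp) + (7 + (size (ecode ev tmp.+1) + 1))
| Out ei ev => size (ecode ei tmp) + (size (ecode ev tmp.+1) + 3)
| Seq c1 c2 => csize c1 + csize c2
| IfLt e1 e2 c1 c2 =>
    size (ecode e1 tmp) + (size (ecode e2 tmp.+1) + (1 + (csize c2 + (1 + csize c1))))
| For r lim c => 3 + (csize c + 3)
end.

Fixpoint code c off : seq instr := match c with
| Skip => [::]
| Assign r e => ecode e tmp ++ [:: Move r tmp]
| Put a ei ev => ecode ei tmp ++ addr a tmp ++ ecode ev tmp.+1 ++ [:: Write tmp tmp.+1]
| Out ei ev => ecode ei tmp ++ ecode ev tmp.+1 ++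
    let o := off + size (ecode ei tmp) + size (ecode ev tmp.+1) in
    [:: JumpLt tmp rB (o + 2); Jump (o + 3); Write tmp tmp.+1]
| Seq c1 c2 => code c1 off ++ code c2 (off + csize c1)
| IfLt e1 e2 c1 c2 => ecode e1 tmp ++ ecode e2 tmp.+1 ++
    let o := off + size (ecode e1 tmp) + size (ecode e2 tmp.+1) in
    [:: JumpLt tmp tmp.+1 (o + csize c2 + 2)] ++ code c2 (o + 1) ++
    [:: Jump (o + csize c2 + 2 + csize c1)] ++ code c1 (o + csize c2 + 2)
| For r lim c =>
    [:: Const r 0; JumpLt r lim (off + 3); Jump (off + csize c + 6)] ++
    code c (off + 3) ++ [:: Const tmp 1; Add r r tmp; Jump (off + 1)]
end.

(** The count is exact. A loop spends 4 extra steps per turn (test, unit constant, increment, jump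
    back) and 3 outside its turns (initialisation, failed test, exit jump); after its operands,
    [Out] takes two steps whether or not it writes. *)
Fixpoint time c s := match c with
| Skip => 0
| Assign r e => size (ecode e tmp) + 1
| Put a ei ev => size (ecode ei tmp) + 7 + size (ecode ev tmp.+1) + 1
| Out ei ev => size (ecode ei tmp) + size (ecode ev tmp.+1) + 2
| Seq c1 c2 => time c1 s + time c2 (run c1 s)
| IfLt e1 e2 c1 c2 => size (ecode e1 tmp) + size (ecode e2 tmp.+1) + 1 +
    (if eval s e1 < eval s e2 then time c1 s else time c2 s + 1)
| For r lim c =>
    3 + \sum_(k < var s lim) (time c (iter k (bump_run r (run c)) (setv r 0 s)) + 4)
end.

(** Both branches of a conditional are charged and loop limits are looked up in the fixed [rho], so
    that the bound does not depend on the store. *)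
Fixpoint cost rho c := match c with
| Skip => 0
| Assign r e => size (ecode e tmp) + 1
| Put a ei ev => size (ecode ei tmp) + 7 + size (ecode ev tmp.+1) + 1
| Out ei ev => size (ecode ei tmp) + size (ecode ev tmp.+1) + 2
| Seq c1 c2 => cost rho c1 + cost rho c2
| IfLt e1 e2 c1 c2 => size (ecode e1 tmp) + size (ecode e2 tmp.+1) + 1 +
    (cost rho c1 + (cost rho c2 + 1))
| For r lim c => 3 + rho lim * (cost rho c + 4)
end.

Fixpoint mods c := match c with
| Assign r _ => [:: r]
| Seq c1 c2 | IfLt _ _ c1 c2 => mods c1 ++ mods c2
| For r _ c => r :: mods c
| _ => [::]
end.

Fixpoint amods c := match c with
| Put a _ _ => [:: a]
| Seq c1 c2 | IfLt _ _ c1 c2 => amods c1 ++ amods c2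
| For _ _ c => amods c
| _ => [::]
end.

Fixpoint outs c := match c with
| Out _ _ => true
| Seq c1 c2 | IfLt _ _ c1 c2 => outs c1 || outs c2
| For _ _ c => outs c
| _ => false
end.

Fixpoint lims c := match c with
| Seq c1 c2 | IfLt _ _ c1 c2 => lims c1 ++ lims c2
| For _ lim c => lim :: lims c
| _ => [::]
end.

Fixpoint expr_ok e := match e with
| Cst _ => true
| Var r => r < tmp
| Raw e => expr_ok e
| Arr a e => expr_ok e
| Plus e1 e2 | Minus e1 e2 => expr_ok e1 && expr_ok e2
end.

(** A loop body may assign neither counter nor limit: the compiled loop tests them anew at each
    turn, whereas [run] fixes the number of turns on entry. Array numbers below 16 prevent
    aliasing. *)
Fixpoint cmd_ok c := match c with
| Skip => true
| Assign r e => (r < tmp) && expr_ok e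
| Put a ei ev => [&& a < 16, expr_ok ei & expr_ok ev]
| Out ei ev => expr_ok ei && expr_ok ev
| Seq c1 c2 => cmd_ok c1 && cmd_ok c2
| IfLt e1 e2 c1 c2 => [&& expr_ok e1, expr_ok e2, cmd_ok c1 & cmd_ok c2]
| For r lim c =>
    [&& r < tmp, lim < tmp, r != lim, r \notin mods c, lim \notin mods c & cmd_ok c]
end.

(** * Correctness and running time of the compiled code *)

Definition steps prog st k st' := iter k (obind (step prog)) (Some st) = Some st'.

Lemma stepsD prog st1 k1 st2 k2 st3 :
  steps prog st1 k1 st2 -> steps prog st2 k2 st3 -> steps prog st1 (k1 + k2) st3.
Proof. by rewrite /steps => h1 h2; rewrite addnC iterD h1. Qed.

Lemma steps1 prog st st' : step prog st = Some st' -> steps prog st 1 st'.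
Proof. by []. Qed.

Lemma stepsS prog st st1 k st2 :
  step prog st = Some st1 -> steps prog st1 k st2 -> steps prog st k.+1 st2.
Proof. by move=> h; apply: (@stepsD _ _ 1); apply: steps1. Qed.

Lemma exec_steps prog st k st' :
  steps prog st k st' -> step prog st' = None -> exec prog st k st'.
Proof.
elim: k st => [|k IH] st; first by case=> ->; exact: ExecHalt.
rewrite /steps iterSr /=; case E: (step prog st) => [st1|] h halted.
  exact: ExecStep E (IH _ h halted).
by move: h; rewrite (_ : iter _ _ _ = None) //; elim: (k) => //= j ->.
Qed.

Definition instr_at prog off l :=
  forall i, i < size l -> nth Halt prog (off + i) = nth Halt l i.

Lemma instr_at_catl prog off l1 l2 : instr_at prog off (l1 ++ l2) -> instr_at prog off l1.
Proof.
move=> h i lt_i; rewrite h ?size_cat; last by lia.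
by rewrite nth_cat lt_i.
Qed.

Lemma instr_at_catr prog off l1 l2 :
  instr_at prog off (l1 ++ l2) -> instr_at prog (off + size l1) l2.
Proof.
move=> h i lt_i; rewrite -addnA h ?size_cat; last by lia.
by rewrite nth_cat ltnNge leq_addr /= addKn.
Qed.

Lemma instr_at_fetch prog off i l : instr_at prog off (i :: l) -> nth Halt prog off = i.
Proof. by move/(_ 0 isT); rewrite addn0. Qed.

Lemma instr_at_behead prog off i l : instr_at prog off (i :: l) -> instr_at prog off.+1 l.
Proof. by rewrite -cat1s => /instr_at_catr; rewrite addn1. Qed.

Lemma size_code c off : size (code c off) = csize c.
Proof.
elim: c off => //= [x e|a ei ev|ei ev|c1 IH1 c2 IH2|e1 e2 c1 IH1 c2 IH2|r l c IH] off.
- by rewrite size_cat.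
- by rewrite size_cat /= size_cat.
- by rewrite !size_cat.
- by rewrite size_cat IH1 IH2.
- by rewrite !size_cat /= size_cat /= IH1 IH2.
- by rewrite size_cat IH.
Qed.

Definition regop (m : nat -> nat) i (rg : nat -> nat) : nat -> nat := match i with
| Const r c => [eta rg with r |-> c]
| Move r a => [eta rg with r |-> rg a]
| Add r a b => [eta rg with r |-> rg a + rg b]
| Defs.Sub r a b => [eta rg with r |-> rg a - rg b]
| Read r a => [eta rg with r |-> m (rg a)]
| _ => rg
end.

Definition is_regop i := match i with
| Const _ _ | Move _ _ | Add _ _ _ | Defs.Sub _ _ _ | Read _ _ => true
| _ => false
end.

Definition regops m l rg := foldl (fun rg i => regop m i rg) rg l.

Lemma regops_cat m l1 l2 rg : regops m (l1 ++ l2) rg = regops m l2 (regops m l1 rg).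
Proof. exact: foldl_cat. Qed.

Lemma regops_steps prog p l m rg : all is_regop l -> instr_at prog p l ->
  steps prog (State p rg m) (size l) (State (p + size l) (regops m l rg) m).
Proof.
elim: l p rg => [|i l IH] p rg /=; first by rewrite addn0.
move=> /andP[ri rl] h; rewrite -addSnnS.
apply: (@stepsD _ _ 1 (State p.+1 (regop m i rg) m)); last first.
  exact: IH (instr_at_behead h).
by apply: steps1; rewrite /step /fetch /= (instr_at_fetch h); case: (i) ri.
Qed.

Lemma ecode_regop e t : all is_regop (ecode e t).
Proof.
elim: e t => //= [e IH|a e IH|e1 IH1 e2 IH2|e1 IH1 e2 IH2] t;
  by rewrite ?all_cat ?IH ?IH1 ?IH2.
Qed.

Definition agree (s : store) (rg : nat -> nat) := forall r, r < tmp -> rg r = var s r.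

Lemma addr_regops m a t rg : rB < t ->
  regops m (addr a t) rg t = rg t * 16 + a + rg rB /\
  forall r, r < t -> regops m (addr a t) rg r = rg r.
Proof.
move=> ltB; rewrite /regops /addr /=; split=> [|r lt_r].
  have -> : rB == t = false by lia.
  have -> : rB == t.+1 = false by lia.
  have -> : t == t.+1 = false by lia.
  rewrite !eqxx.
  lia.
have -> : r == t = false by lia.
by have -> : r == t.+1 = false by lia.
Qed.

Lemma regops1 m i rg : regops m [:: i] rg = regop m i rg.
Proof. by []. Qed.

Arguments addr : simpl never.
Arguments regops : simpl never.

Lemma ecode_correct s e t rg : expr_ok e -> tmp <= t -> agree s rg ->
  regops (ram s) (ecode e t) rg t = eval s e /\
  forall r, r < t -> regops (ram s) (ecode e t) rg r = rg r.
Proof.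
have bin e1 e2 : forall t rg, tmp <= t -> agree s rg ->
    (forall t rg, tmp <= t -> agree s rg ->
       regops (ram s) (ecode e1 t) rg t = eval s e1 /\
       forall r, r < t -> regops (ram s) (ecode e1 t) rg r = rg r) ->
    (forall t rg, tmp <= t -> agree s rg ->
       regops (ram s) (ecode e2 t) rg t = eval s e2 /\
       forall r, r < t -> regops (ram s) (ecode e2 t) rg r = rg r) ->
    let rg' := regops (ram s) (ecode e1 t ++ ecode e2 t.+1) rg in
    [/\ rg' t = eval s e1, rg' t.+1 = eval s e2 & forall r, r < t -> rg' r = rg r].
  move=> {}t {}rg le_t ag h1 h2; rewrite /= regops_cat.
  have [v1 f1] := h1 t rg le_t ag.
  have ag1 : agree s (regops (ram s) (ecode e1 t) rg).
    by move=> r lt_r; rewrite f1 ?ag //; lia.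
  have [v2 f2] := h2 t.+1 _ (leqW le_t) ag1.
  split=> [|//|r lt_r]; first by rewrite f2.
  by rewrite f2 ?f1 // ltnS ltnW.
elim: e t rg => [c|r0|e IH|a e IH|e1 IH1 e2 IH2|e1 IH1 e2 IH2] t rg ok le_t ag;
  rewrite ?[expr_ok _]/= in ok.
- by rewrite regops1 /= eqxx; split=> // r lt_r; case: eqP => //; lia.
- by rewrite regops1 /= eqxx ag //; split=> // r lt_r; case: eqP => //; lia.
- have [v f] := IH t rg ok le_t ag.
  rewrite [ecode _ _]/(ecode e t ++ [:: Read t t]) regops_cat regops1 /= eqxx v; split=> // r lt_r.
  by rewrite -(f r lt_r); case: eqP => //; lia.
- have [v f] := IH t rg ok le_t ag.
  have ltB : rB < t by rewrite /rB /tmp in le_t *; lia.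
  have [v' f'] := @addr_regops (ram s) a t (regops (ram s) (ecode e t) rg) ltB.
  rewrite [ecode _ _]/(ecode e t ++ addr a t ++ [:: Read t t]).
  rewrite regops_cat (regops_cat _ (addr a t)) regops1 /= eqxx v' v (f rB) // ag //.
  split=> // r lt_r.
  by rewrite -(f r lt_r) -(f' r lt_r); case: eqP => //; lia.
- have /andP[ok1 ok2] := ok.
  have [v1 v2 f] := bin e1 e2 t rg le_t ag
    (fun t rg => IH1 t rg ok1) (fun t rg => IH2 t rg ok2).
  rewrite [ecode _ _]/= catA regops_cat regops1 /= eqxx v1 v2; split=> // r lt_r.
  by rewrite -(f r lt_r); case: eqP => //; lia.
- have /andP[ok1 ok2] := ok.
  have [v1 v2 f] := bin e1 e2 t rg le_t ag
    (fun t rg => IH1 t rg ok1) (fun t rg => IH2 t rg ok2).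
  rewrite [ecode _ _]/= catA regops_cat regops1 /= eqxx v1 v2; split=> // r lt_r.
  by rewrite -(f r lt_r); case: eqP => //; lia.
Qed.

Lemma ecode_steps prog p s e t rg : expr_ok e -> tmp <= t -> agree s rg ->
  instr_at prog p (ecode e t) ->
  exists rg', [/\ steps prog (State p rg (ram s)) (size (ecode e t))
                    (State (p + size (ecode e t)) rg' (ram s)),
    agree s rg', rg' t = eval s e & forall r, r < t -> rg' r = rg r].
Proof.
move=> ok le_t ag h.
have [v f] := ecode_correct ok le_t ag.
exists (regops (ram s) (ecode e t) rg); split=> //.
- exact: regops_steps (ecode_regop e t) h.
- by move=> r lt_r; rewrite f ?ag //; lia.
Qed.

Lemma ecode2_steps prog p s e1 e2 rg : expr_ok e1 -> expr_ok e2 -> agree s rg ->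
  instr_at prog p (ecode e1 tmp ++ ecode e2 tmp.+1) ->
  exists rg', [/\ steps prog (State p rg (ram s)) (size (ecode e1 tmp) + size (ecode e2 tmp.+1))
                    (State (p + size (ecode e1 tmp) + size (ecode e2 tmp.+1)) rg' (ram s)),
    agree s rg', rg' tmp = eval s e1 & rg' tmp.+1 = eval s e2].
Proof.
move=> ok1 ok2 ag h.
have [rg1 [s1 ag1 v1 _]] := ecode_steps ok1 (leqnn _) ag (instr_at_catl h).
have [rg2 [s2 ag2 v2 f2]] := ecode_steps ok2 (leqnSn _) ag1 (instr_at_catr h).
exists rg2; split=> //; first exact: stepsD s1 s2.
by rewrite f2.
Qed.

Lemma agree_tmp s rg v : agree s rg -> agree s [eta rg with tmp |-> v].
Proof. by move=> ag r lt_r /=; case: eqP lt_r => [->|_] lt_r; rewrite ?ag ?ltnn. Qed.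

Lemma agree_setv s rg r v : agree s rg -> agree (setv r v s) [eta rg with r |-> v].
Proof. by move=> ag x lt_x; rewrite /= /upd; case: eqP => // _; apply: ag. Qed.

Lemma iter_mod r c k s lim : lim != r ->
  (forall s, var (run c s) lim = var s lim) ->
  var (iter k (bump_run r (run c)) s) lim = var s lim.
Proof.
move=> ne h; elim: k => //= k IH.
by rewrite /upd (negPf ne) h.
Qed.

Lemma var_mods c s r : r \notin mods c -> var (run c s) r = var s r.
Proof.
elim: c s => //= [x e|ei ev|c1 IH1 c2 IH2|e1 e2 c1 IH1 c2 IH2|x l c IH] s.
- by rewrite inE /upd => /negPf->.
- by rewrite /out; case: ifP.
- by rewrite mem_cat negb_or => /andP[h1 h2]; rewrite IH2 ?IH1.
- by rewrite mem_cat negb_or => /andP[h1 h2]; case: ifP; rewrite ?IH2 ?IH1.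
- rewrite inE negb_or => /andP[ne h]; rewrite iter_mod //=; last by move=> ?; apply: IH.
  by rewrite /upd (negPf ne).
Qed.

(** Registers from [tmp] on are scratch, so only agreement below [tmp] is carried through the
    induction. *)
Lemma code_steps c prog p s rg : cmd_ok c -> agree s rg -> instr_at prog p (code c p) ->
  exists2 rg', agree (run c s) rg' &
    steps prog (State p rg (ram s)) (time c s) (State (p + csize c) rg' (ram (run c s))).
Proof.
elim: c p s rg => [|r e|a ei ev|ei ev|c1 IH1 c2 IH2|e1 e2 c1 IH1 c2 IH2|r lim c IH] p s rg.
- by exists rg; rewrite //= addn0.
- move=> /= /andP[_ ok] ag h.
  have [rg1 [s1 ag1 v1 _]] := ecode_steps ok (leqnn _) ag (instr_at_catl h).
  exists [eta rg1 with r |-> rg1 tmp]; first by rewrite v1; apply: agree_setv.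
  rewrite addnA; apply: stepsD s1 _; apply: steps1.
  by rewrite /step /fetch /= (instr_at_fetch (instr_at_catr h)) addn1.
- move=> /and3P[_ ok1 ok2] ag h.
  have {}h : instr_at prog p
    (ecode ei tmp ++ addr a tmp ++ ecode ev tmp.+1 ++ [:: Write tmp tmp.+1]) := h.
  have [rg1 [s1 ag1 v1 _]] := ecode_steps ok1 (leqnn _) ag (instr_at_catl h).
  have h1 := instr_at_catr h; have h2 := instr_at_catr h1; have h3 := instr_at_catr h2.
  rewrite [size (addr _ _)]/= in h2 h3; have [//|va fa] := @addr_regops (ram s) a tmp rg1.
  set rg2 := regops (ram s) (addr a tmp) rg1 in va fa.
  have s2 := @regops_steps prog _ (addr a tmp) (ram s) rg1 isT (instr_at_catl h1).
  rewrite [size (addr _ _)]/= in s2.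
  have ag2 : agree s rg2 by move=> r lt_r; rewrite fa ?ag1.
  have [rg3 [s3 ag3 v3 f3]] := ecode_steps ok2 (leqnSn _) ag2 (instr_at_catl h2).
  exists rg3; first exact: ag3.
  rewrite [time _ _]/=; apply: stepsD (stepsD (stepsD s1 s2) s3) _; apply: steps1.
  rewrite /step /fetch /= (instr_at_fetch h3) f3 // va v1 v3 ag1 //.
  congr (Some (State _ _ _)); lia.
- move=> /= /andP[ok1 ok2] ag; rewrite catA => h.
  have [rg1 [s1 ag1 v1 v2]] := ecode2_steps ok1 ok2 ag (instr_at_catl h).
  have h1 := instr_at_catr h; rewrite size_cat addnA in h1.
  have h2 := instr_at_behead h1; have h3 := instr_at_behead h2.
  exists rg1; first by rewrite /out; case: ifP.
  apply: stepsD s1 _; apply: stepsS.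
    by rewrite /step /fetch /= (instr_at_fetch h1) v1 ag1.
  apply: steps1; rewrite /out; case: ifP => _; rewrite /step /fetch /=.
    by rewrite addn2 (instr_at_fetch h3) v1 v2 !addnA addn3.
  by rewrite (instr_at_fetch h2) !addnA.
- move=> /= /andP[ok1 ok2] ag h.
  have [rg1 ag1 s1] := IH1 _ _ _ ok1 ag (instr_at_catl h).
  have h2 := instr_at_catr h; rewrite size_code in h2.
  have [rg2 ag2 s2] := IH2 _ _ _ ok2 ag1 h2.
  by exists rg2 => //; rewrite addnA; apply: stepsD s1 s2.
- move=> /= /and4P[ok1 ok2 okc1 okc2] ag; rewrite catA => h.
  have [rg1 [s1 ag1 v1 v2]] := ecode2_steps ok1 ok2 ag (instr_at_catl h).
  have h1 := instr_at_catr h; rewrite size_cat addnA in h1.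
  have h2 := instr_at_behead h1; rewrite -addn1 in h2.
  have h3 := instr_at_catr h2; rewrite size_code in h3.
  have h4 := instr_at_behead h3.
  set o := p + _ + _ in s1 h1 h2 h3 h4 *.
  have ho : o + csize c2 + 2 = (o + 1 + csize c2).+1 by lia.
  case: ifP => lt_e.
    rewrite -ho in h4.
    have [rg2 ag2 s2] := IH1 _ _ _ okc1 ag1 h4.
    exists rg2 => //; rewrite -addnA; apply: stepsD s1 _; apply: stepsD.
      by apply: steps1; rewrite /step /fetch /= (instr_at_fetch h1) v1 v2 lt_e.
    by rewrite (_ : p + _ = o + csize c2 + 2 + csize c1) //; rewrite /o; lia.
  have [rg2 ag2 s2] := IH2 _ _ _ okc2 ag1 (instr_at_catl h2).
  exists rg2 => //; rewrite -addnA; apply: stepsD s1 _; apply: stepsD; last apply: stepsD s2 _.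
    by apply: steps1; rewrite /step /fetch /= (instr_at_fetch h1) v1 v2 lt_e addn1.
  apply: steps1; rewrite /step /fetch /= (instr_at_fetch h3).
  by congr (Some (State _ _ _)); rewrite /o; lia.
- move=> /= /and5P[lt_r lt_lim ne_r nr /andP[nlim ok]] ag h.
  have h1 := instr_at_behead h; have h2 := instr_at_behead h1.
  have h3 := instr_at_behead h2; rewrite -(addn3 p) in h3.
  have h4 := instr_at_catr h3; rewrite size_code in h4.
  have h5 := instr_at_behead h4; have h6 := instr_at_behead h5.
  set N := var s lim; set f := bump_run r (run c); set s0 := setv r 0 s.
  have eN k : var (iter k f s0) lim = N.
    rewrite iter_mod; first by rewrite /= /upd eq_sym (negPf ne_r).
      by rewrite eq_sym.
    by move=> ?; apply: var_mods.
  have eR k : var (iter k f s0) r = k.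
    elim: k => [|k IHk] /=; first by rewrite /upd eqxx.
    by rewrite /upd eqxx var_mods ?IHk.
  (* The state at the loop test, address [p.+1], after [j] turns; the leading 1 pays for the
     initialisation of the counter. *)
  have loop j : j <= N -> exists2 rg', agree (iter j f s0) rg' &
      steps prog (State p rg (ram s)) (1 + \sum_(k < j) (time c (iter k f s0) + 4))
        (State p.+1 rg' (ram (iter j f s0))).
    elim: j => [_|j IHj lt_j].
      exists [eta rg with r |-> 0]; first exact: agree_setv.
      rewrite big_ord0; apply: steps1.
      by rewrite /step /fetch /= (instr_at_fetch h).
    have [rg1 ag1 s1] := IHj (ltnW lt_j).
    have [rg2 ag2 s2] := IH _ _ _ ok ag1 (instr_at_catl h3).
    exists [eta [eta rg2 with tmp |-> 1] with r |-> (var (run c (iter j f s0)) r).+1].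
      exact/agree_setv/agree_tmp.
    rewrite big_ord_recr /= addnA; apply: stepsD s1 _.
    have -> : time c (iter j f s0) + 4 = (time c (iter j f s0) + 3).+1 by lia.
    apply: stepsS.
      by rewrite /step /fetch /= (instr_at_fetch h1) !ag1.
    rewrite eR eN lt_j; apply: stepsD s2 _.
    have ne_r' : r == tmp = false by rewrite /tmp in lt_r *; lia.
    apply: stepsS; first by rewrite /step /fetch /= (instr_at_fetch h4).
    apply: stepsS; first by rewrite /step /fetch /= (instr_at_fetch h5).
    apply: steps1; rewrite /step /fetch /= (instr_at_fetch h6) ne_r'.
    by rewrite ag2 // !addn1.
  have [rg1 ag1 s1] := loop N (leqnn _).
  exists rg1 => //.
  set S := \sum_(_ < _) _ in s1 *.
  have -> : 3 + S = 1 + S + (1 + 1) by lia.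
  apply: stepsD s1 _; apply: stepsD.
    by apply: steps1; rewrite /step /fetch /= (instr_at_fetch h1) !ag1.
  rewrite eR eN ltnn; apply: steps1; rewrite /step /fetch /= (instr_at_fetch h2).
  by congr (Some (State _ _ _)); lia.
Qed.

(** Limits are assigned nowhere in [c], so each loop, however nested and whenever entered, still
    sees the value given by [rho]. *)
Lemma time_cost rho c s : {in lims c, forall r, var s r = rho r} ->
  ~~ has (mem (mods c)) (lims c) -> time c s <= cost rho c.
Proof.
have sub (s1 s2 : seq nat) : ~~ has (mem s1) s2 -> {in s2, forall r, r \notin s1}.
  by move=> /hasPn.
elim: c s => //= [c1 IH1 c2 IH2|e1 e2 c1 IH1 c2 IH2|x l c IH] s hl;
  rewrite ?has_cat.
- rewrite negb_or => /andP[/sub n1 /sub n2].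
  apply: leq_add.
    apply: IH1 => [r hr|]; first by rewrite hl // mem_cat hr.
    by apply/hasPn => r /n1; rewrite mem_cat negb_or => /andP[].
  apply: IH2 => [r hr|].
    have := n2 _ hr; rewrite mem_cat negb_or => /andP[nr _].
    by rewrite var_mods // hl // mem_cat hr orbT.
  by apply/hasPn => r /n2; rewrite mem_cat negb_or => /andP[].
- rewrite negb_or => /andP[/sub n1 /sub n2].
  have t1 : time c1 s <= cost rho c1.
    apply: IH1 => [r hr|]; first by rewrite hl // mem_cat hr.
    by apply/hasPn => r /n1; rewrite mem_cat negb_or => /andP[].
  have t2 : time c2 s <= cost rho c2.
    apply: IH2 => [r hr|]; first by rewrite hl // mem_cat hr orbT.
    by apply/hasPn => r /n2; rewrite mem_cat negb_or => /andP[].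
  by case: ifP; lia.
- rewrite negb_or -/(has _ _) => /andP[nl /sub nc].
  rewrite leq_add2l -hl ?mem_head //.
  rewrite -[X in X * _]card_ord -sum_nat_const; apply: leq_sum => k _.
  rewrite leq_add2r; apply: IH => [r hr|].
    have := nc _ hr; rewrite inE negb_or => /andP[ne nr].
    rewrite iter_mod //=; last by move=> ?; apply: var_mods.
    by rewrite /upd (negPf ne) hl // inE hr orbT.
  by apply/hasPn => r /nc; rewrite inE negb_or => /andP[].
Qed.

(** * Arrays, frames and the loop invariant rule *)

Lemma arr_setv r v s a i : r != rB -> arr (setv r v s) a i = arr s a i.
Proof. by move=> ne; rewrite /arr /cell /= /upd eq_sym (negPf ne). Qed.

(** Relative to the base, the address i * 16 + a with a < 16 determines index and array by Euclidean
    division. *)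
Lemma arr_put a i v s a' i' : a < 16 -> a' < 16 ->
  arr (put a i v s) a' i' = if (a' == a) && (i' == i) then v else arr s a' i'.
Proof.
move=> lt_a lt_a'; rewrite /arr /cell /= /upd eqn_add2r.
by congr (if _ then _ else _); apply/eqP/andP => [|[/eqP-> /eqP->]//]; lia.
Qed.

Lemma ram_put a i v s j : j < var s rB -> ram (put a i v s) j = ram s j.
Proof. by move=> lt_j; rewrite /= /upd /cell; case: eqP => // eq_j; lia. Qed.

Lemma var_out j v s : var (out j v s) = var s.
Proof. by rewrite /out; case: ifP. Qed.

Lemma arr_out j v s a i : arr (out j v s) a i = arr s a i.
Proof.
rewrite /out; case: ifP => // lt_j; rewrite /arr /cell /= /upd.
by case: eqP => //; lia.
Qed.

Lemma ram_out j v s x :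
  j < var s rB -> ram (out j v s) x = if x == j then v else ram s x.
Proof. by rewrite /out => ->. Qed.

(** Arrays are addressed relative to [rB], hence the conditions on it. Only [Out] can change the raw
    area, as all array cells lie above it. *)
Record frame c s s' : Prop := Frame {
  frame_var : forall r, r \notin mods c -> var s' r = var s r;
  frame_arr : rB \notin mods c ->
    forall a i, a < 16 -> a \notin amods c -> arr s' a i = arr s a i;
  frame_ram : rB \notin mods c -> ~~ outs c ->
    forall j, j < var s rB -> ram s' j = ram s j
}.

Lemma frame_refl c s : frame c s s.
Proof. by []. Qed.

Lemma frame_trans c s1 s2 s3 : frame c s1 s2 -> frame c s2 s3 -> frame c s1 s3.
Proof.
move=> [v1 a1 r1] [v2 a2 r2]; split=> [r hr|hB a i lta na|hB ho j ltj].
- by rewrite v2 ?v1.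
- by rewrite a2 ?a1.
- by rewrite r2 ?r1 // v1.
Qed.

Lemma frame_sub c c' s s' : {subset mods c <= mods c'} -> {subset amods c <= amods c'} ->
  outs c ==> outs c' -> frame c s s' -> frame c' s s'.
Proof.
move=> sm sa so [fv fa fr]; split=> [r hr|hB a i lta na|hB ho j ltj].
- by apply: fv; apply: contra hr; apply: sm.
- by apply: fa => //; [apply: contra hB; apply: sm | apply: contra na; apply: sa].
- apply: fr => //; first by apply: contra hB; apply: sm.
  by apply: contra ho; apply: implyP.
Qed.

Lemma frame_setv r lim c v s s' : frame (For r lim c) s s' ->
  frame (For r lim c) s (setv r v s').
Proof.
move=> [fv fa fr]; split=> [x|hB a i lta na|hB ho j ltj] /=.
- by rewrite inE negb_or /upd => /andP[/negPf ne nx]; rewrite ne fv // inE ne.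
- rewrite arr_setv ?fa //; first by rewrite eq_sym; move: hB; rewrite inE negb_or => /andP[].
- exact: fr.
Qed.

Lemma frame_catl c1 c2 s s' : frame c1 s s' -> frame (Seq c1 c2) s s'.
Proof.
apply: frame_sub; first by move=> x hx; rewrite mem_cat hx.
  by move=> x hx; rewrite mem_cat hx.
by apply/implyP => /= ->.
Qed.

Lemma frame_catr c1 c2 s s' : frame c2 s s' -> frame (Seq c1 c2) s s'.
Proof.
apply: frame_sub; first by move=> x hx; rewrite mem_cat hx orbT.
  by move=> x hx; rewrite mem_cat hx orbT.
by apply/implyP => /= ->; rewrite orbT.
Qed.

Lemma frame_body r lim c s s' : frame c s s' -> frame (For r lim c) s s'.
Proof.
by apply: frame_sub => [x hx|x //|]; [rewrite inE hx orbT | apply/implyP].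
Qed.

Lemma run_frame c s : cmd_ok c -> frame c s (run c s).
Proof.
elim: c s => [|r e|a ei ev|ei ev|c1 IH1 c2 IH2|e1 e2 c1 IH1 c2 IH2|r lim c IH] s.
- by [].
- move=> _; split=> [x|hB a i _ _|//] /=; first by rewrite inE /upd => /negPf->.
  by rewrite arr_setv // eq_sym -mem_seq1.
- move=> /andP[lta _]; split=> [//|hB a' i lta'|hB _ j ltj] /=.
    by rewrite inE arr_put // => /negPf->.
  exact: (ram_put a (eval s ei) (eval s ev) ltj).
- by move=> _; split=> // [r _|_ a i _ _] /=; rewrite ?var_out ?arr_out.
- move=> /= /andP[/IH1 f1 /IH2 f2]; apply: (@frame_trans _ _ (run c1 s)).
    exact: frame_catl (f1 s).
  exact: frame_catr (f2 _).
- move=> /= /and4P[_ _ /IH1 f1 /IH2 f2].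
  apply: (@frame_sub (Seq c1 c2)) => //; first exact/implyP.
  by case: ifP => _; [exact: frame_catl | exact: frame_catr].
- move=> /= /and5P[_ _ _ _ /andP[_ /IH f]].
  elim: (var s lim) => [|k IHk] /=; first exact: frame_setv (frame_refl _ s).
  apply: frame_setv; apply: frame_trans IHk _.
  exact: frame_body (f _).
Qed.

Lemma run_iter r lim c s :
  run (For r lim c) s = iter (var s lim) (bump_run r (run c)) (setv r 0 s).
Proof. by []. Qed.

(** Frame and counter are proved along with [I], so an invariant need only mention what the loop
    changes. All intermediate states are covered, as the simulation needs the positions at every
    time. *)
Lemma iter_next (I : nat -> store -> Prop) r lim c s : cmd_ok (For r lim c) ->
  I 0 (setv r 0 s) ->
  (forall k s', k < var s lim -> frame (For r lim c) s s' -> var s' r = k ->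
     I k s' -> I k.+1 (setv r k.+1 (run c s'))) ->
  forall k, k <= var s lim -> let s' := iter k (bump_run r (run c)) (setv r 0 s) in
  [/\ I k s', frame (For r lim c) s s' & var s' r = k].
Proof.
move=> ok h0 hS; elim=> [|k IHk] lt_k /=.
  by split=> //; [apply: frame_setv (frame_refl _ s)|rewrite /upd eqxx].
have /and5P[_ _ _ nr /andP[_ okc]] := ok.
have [hI fr rk] := IHk (ltnW lt_k).
rewrite /bump_run var_mods // rk; split; first exact: hS.
  apply: frame_setv; apply: frame_trans fr _.
  exact: frame_body (run_frame _ okc).
by rewrite /= /upd eqxx.
Qed.

Lemma for_rule (I : nat -> store -> Prop) r lim c s : cmd_ok (For r lim c) ->
  I 0 (setv r 0 s) ->
  (forall k s', k < var s lim -> frame (For r lim c) s s' -> var s' r = k ->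
     I k s' -> I k.+1 (setv r k.+1 (run c s'))) ->
  I (var s lim) (run (For r lim c) s).
Proof. by move=> ok h0 hS; have [] := iter_next ok h0 hS (leqnn _). Qed.

(** * Potentials and flows *)

Section Potential.
Variables (T : finType) (e : rel T).
Implicit Types (phi d : T -> nat) (f : T -> T -> nat).

Definition lipschitz phi := forall u v, e u v -> phi u <= (phi v).+1.
(** Complementary slackness. It also makes the support of [f] acyclic. *)
Definition tight phi f := forall u v, 0 < f u v -> e u v /\ phi u = (phi v).+1.
Definition outflow f v := \sum_w f v w.
Definition inflow f v := \sum_w f w v.

Lemma dist_path u v : connect e u v ->
  exists p, [/\ path e u p, last u p = v, size p = dist e u v & dist e u v < #|T|].
Proof.
move=> /connectP[p0 /shortenP[p path_p uniq_p _] ev].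
pose a k := [exists w : k.-tuple T, path e u w && (last u w == v)].
have lt_p : size p < #|T| by have := max_card (mem (u :: p)); rewrite (card_uniqP uniq_p).
have ha : has a (iota 0 #|T|).
  apply/hasP; exists (size p); first by rewrite mem_iota.
  by apply/existsP; exists (in_tuple p); rewrite path_p ev /=.
have lt_d : dist e u v < #|T| by rewrite -[#|T|](size_iota 0) -has_find.
have /existsP[w /andP[pw /eqP lw]] := nth_find 0 ha.
exists w; split=> //; rewrite size_tuple nth_iota ?add0n //.
Qed.

Lemma lip_path phi u p : lipschitz phi -> path e u p -> phi u <= phi (last u p) + size p.
Proof.
move=> lip; elim: p u => [|v p IH] u /=; first by rewrite addn0.
by move=> /andP[/lip le_uv /IH]; lia.
Qed.

Lemma lip_dist phi u v : connect e u v -> lipschitz phi -> phi u <= phi v + dist e u v.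
Proof. by move=> /dist_path[p [path_p <- <- _]] lip; apply: lip_path. Qed.

(* Length of the residual arc (v, w) reduced by phi.  When w sends flow to v,
   cancelling it is a tight arc; otherwise the arc is traversed forwards. *)
Definition rcost phi f v w := if 0 < f w v then 0 else (phi w).+1 - phi v.

Section DualStep.
Variables (phi d : T -> nat) (f : T -> T -> nat) (D : nat).
Hypotheses (e_sym : symmetric e) (lip : lipschitz phi) (tgt : tight phi f).
Hypothesis relaxed : forall v w, e v w -> d w <= d v + rcost phi f v w.

(** The usual update phi - min (d, D), shifted by [D] to stay in the natural numbers. Vertices at
    distance [D] or more keep their potential; with [D] the distance of a nearest unserved goal,
    unserved goals stay at potential 0. *)
Let phi' v := phi v + (D - d v).

Lemma rcost_rev v w : 0 < f w v -> rcost phi f w v = 0.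
Proof.
move=> fwv; have [_ eq_w] := tgt fwv.
by rewrite /rcost; case: ifP => // _; lia.
Qed.

(** Relaxation bounds the growth of [d] from v to w by the slack of the edge, so v gains on w at
    most that slack. *)
Lemma raise_lip : lipschitz phi'.
Proof.
move=> v w vw; rewrite /phi'; have := relaxed vw; have := lip vw.
rewrite /rcost; case: ifP => [/tgt[_ eq_w]|_]; lia.
Qed.

(** An edge carrying flow costs 0 in both directions, hence its ends have equal [d] and are raised
    by the same amount. *)
Lemma raise_tight : tight phi' f.
Proof.
move=> v w fvw; have [vw eq_v] := tgt fvw; split=> //; rewrite /phi'.
have wv : e w v by rewrite e_sym.
have := relaxed vw; have := relaxed wv; rewrite (rcost_rev fvw) /rcost fvw; lia.
Qed.

(* Arcs realising the distances up to D become tight, in one direction or the other. *)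
Lemma raise_arc v w : e v w -> d w = d v + rcost phi f v w -> d w <= D ->
  if 0 < f w v then phi' w = (phi' v).+1 else phi' v = (phi' w).+1.
Proof.
move=> vw eq_d le_D; rewrite /phi'; have := lip vw; move: eq_d.
by rewrite /rcost; case: ifP => [/tgt[_ eq_w]|_]; lia.
Qed.

(** Reduced costs telescope to the length of the path plus the change of [phi]; an arc that cancels
    flow costs even less. *)
Lemma relaxed_path u p : path e u p -> d (last u p) + phi u <= d u + size p + phi (last u p).
Proof.
elim: p u => [|v p IH] u /=; first by rewrite addn0.
move=> /andP[uv /IH]; have := relaxed uv; have := lip uv.
by rewrite /rcost; case: ifP => [/tgt[_ eq_v]|_]; lia.
Qed.

(** A shortest path of G itself is a witness. For an unserved start and an unserved goal this keeps
    the search below its cap. *)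
Lemma relaxed_lt u v : connect e u v -> d u = 0 -> phi v = 0 -> d v < #|T|.
Proof.
move=> /dist_path[p [path_p lp sz lt_d]] du0 pv0.
by have := relaxed_path path_p; rewrite lp; lia.
Qed.

End DualStep.

Lemma outflow_incr f f' a b v :
  (forall u w, f' u w = f u w + ((u == a) && (w == b))) ->
  outflow f' v = outflow f v + (v == a).
Proof.
move=> h; rewrite /outflow (eq_bigr (fun w => f v w + ((v == a) && (w == b)))) //.
rewrite big_split /=; congr addn; rewrite (bigD1 b) //= eqxx andbT big1 ?addn0 // => w.
by move/negPf->; rewrite andbF.
Qed.

Lemma inflow_incr f f' a b v :
  (forall u w, f' u w = f u w + ((u == a) && (w == b))) ->
  inflow f' v = inflow f v + (v == b).
Proof.
move=> h; rewrite /inflow (eq_bigr (fun w => f w v + ((w == a) && (v == b)))) //.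
rewrite big_split /=; congr addn; rewrite (bigD1 a) //= eqxx big1 ?addn0 // => w.
by move/negPf->.
Qed.

End Potential.

(** * Schedules along a flow *)

Section Moves.
Variables (T : finType) (n : nat).
Implicit Types (p : nat -> T) (P : 'I_n -> nat -> T) (phi : T -> nat).

Definition moves p k := count (fun j => p j != p j.+1) (iota 0 k).

Lemma movesS p k : moves p k.+1 = moves p k + (p k != p k.+1).
Proof. by rewrite /moves -[X in iota 0 X]addn1 iotaD count_cat add0n /= addn0. Qed.

(** Weak duality for a single agent: waiting preserves [phi], and crossing an edge lowers it by at
    most one. *)
Lemma lip_moves (e : rel T) phi p k : lipschitz e phi ->
  (forall j, j < k -> e (p j) (p j.+1) \/ p j = p j.+1) ->
  phi (p 0) <= phi (p k) + moves p k.
Proof.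
move=> lip; elim: k => [|k IH] h; first by rewrite leq_addr.
rewrite movesS; apply: leq_trans (IH _) _; first by move=> j lt_j; apply: h; lia.
case: eqP => [->|ne]; first by lia.
by have [/lip|//] := h k (leqnn _); lia.
Qed.

Definition move_pairs P k :=
  [seq x <- [seq (i, j) | i <- enum 'I_n, j <- iota 0 k] | P x.1 x.2 != P x.1 x.2.+1].

Lemma mem_move_pairs P k i j :
  ((i, j) \in move_pairs P k) = (P i j != P i j.+1) && (j < k).
Proof.
rewrite mem_filter /=; congr andb; apply/allpairsP/idP => [[[i' j'] /= []]|lt_j].
  by rewrite mem_iota => _ lt_j [_ ->].
by exists (i, j); rewrite mem_enum mem_iota.
Qed.

Lemma move_pairs_uniq P k : uniq (move_pairs P k).
Proof.
apply: filter_uniq; apply: allpairs_uniq; rewrite ?enum_uniq ?iota_uniq //.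
by move=> [? ?] [? ?].
Qed.

Lemma size_move_pairs P k : size (move_pairs P k) = \sum_i moves (P i) k.
Proof.
rewrite size_filter count_flatten -map_comp sumnE big_map big_enum /=.
by apply: eq_bigr => i _; rewrite count_map.
Qed.

Lemma total_distance_ge P D k : total_distance P D -> \sum_i moves (P i) k <= D.
Proof.
move=> [r [_ mem_r <-]]; rewrite -size_move_pairs.
apply: uniq_leq_size (move_pairs_uniq P k) _ => -[i j].
by rewrite mem_move_pairs mem_r => /andP[].
Qed.

Lemma total_distance_eq P K : (forall i k, K <= k -> P i k = P i k.+1) ->
  total_distance P (\sum_i moves (P i) K).
Proof.
move=> h; exists (move_pairs P K); split; rewrite ?size_move_pairs ?move_pairs_uniq //.
move=> i k; rewrite mem_move_pairs; case: (ltnP k K) => le_k; first by rewrite andbT.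
by rewrite (h i k le_k) eqxx.
Qed.

End Moves.

(** The dual bound involves the goals only through this sum, so it is the same for every
    assignment. *)
Lemma sum_perm_on (T : finType) n (xG : 'I_n -> T) (s : {perm T}) (phi : T -> nat) :
  injective xG -> perm_on [set xG i | i : 'I_n] s ->
  \sum_i phi (s (xG i)) = \sum_i phi (xG i).
Proof.
move=> inj on_s; set G := [set _ | _ in _] in on_s.
have E (F : T -> nat) : \sum_i F (xG i) = \sum_(v in G) F v.
  by rewrite big_imset /=; [apply: eq_bigl | move=> x y _ _; apply: inj].
rewrite (E (phi \o s)) E /= [RHS](reindex_inj (@perm_inj _ s)).
by apply: eq_bigl => v; rewrite perm_closed.
Qed.

Section Schedule.
Variables (T : finType) (n : nat) (e : rel T) (xI xG : 'I_n -> T).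
Hypothesis inst : fcg_instance e xI xG.
Variables (phi : T -> nat) (K : nat).
Variables (pos : nat -> 'I_n -> T) (f : nat -> T -> T -> nat).

(** Conservation with a unit source at each agent's current vertex and a unit sink at each goal: the
    remaining flow still leads from the agents to the goals. *)
Definition balanced (g : T -> T -> nat) (x : 'I_n -> T) := forall v,
  outflow g v + (v \in codom xG) = inflow g v + (v \in codom x).

(** What the schedule argument needs from one greedy time step. In [step_blocked] the blocker may
    stand elsewhere than at [w]: only its level, one below the waiting agent, matters. *)
Record flow_step (g g' : T -> T -> nat) (x x' : 'I_n -> T) : Prop := FlowStep {
  step_move : forall i, x' i = x i \/ 0 < g (x i) (x' i);
  step_inj : injective x';
  step_flow : forall u w, g' u w <= g u w;
  step_blocked : forall i w, x' i = x i -> 0 < g (x i) w ->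
    exists j, 0 < g (x i) (x' j)
}.

Hypotheses (lip : lipschitz e phi) (tgt : tight e phi (f 0)).
Hypothesis phi_lt : forall v, phi v < #|T|.
Hypothesis pos0 : pos 0 =1 xI.
Hypothesis bal : forall k, k <= K -> balanced (f k) (pos k).
Hypothesis stp : forall k, k < K -> flow_step (f k) (f k.+1) (pos k) (pos k.+1).
Hypothesis K_large : #|T| + n <= K.+1.

Let active k i := [exists w, 0 < f k (pos k i) w].
Let M := \max_i phi (xI i).

Lemma tightk k : k <= K -> tight e phi (f k).
Proof.
elim: k => // k IH lt_k u v fuv; apply: (IH (ltnW lt_k)).
exact: leq_trans fuv (step_flow (stp lt_k) u v).
Qed.

Lemma posk_inj k : k <= K -> injective (pos k).
Proof.
case: k => [_ i j|k lt_k]; last exact: step_inj (stp lt_k).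
by rewrite !pos0; apply: (fcg_injI inst).
Qed.

(** Without outflow, the unit source at the vertex forces it to be a goal with no inflow. Hence an
    arrived agent stands in nobody's way. *)
Lemma inactive_goal k i : k <= K -> ~~ active k i ->
  pos k i \in codom xG /\ forall u, f k u (pos k i) = 0.
Proof.
move=> le_k; rewrite negb_exists => /forallP out0.
have := bal le_k (pos k i); rewrite codom_f /outflow big1; last first.
  by move=> w _; have := out0 w; rewrite lt0n negbK => /eqP.
case: (_ \in _) => //; last by rewrite /= addn1.
rewrite add0n addn1 => -[] /esym/eqP; rewrite sum_nat_eq0 => /forallP h; split=> // u.
exact/eqP/h.
Qed.

Lemma inactive_stay k i : k < K -> ~~ active k i ->
  pos k.+1 i = pos k i /\ ~~ active k.+1 i.
Proof.
move=> lt_k na; have st := stp lt_k.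
have eq_pos : pos k.+1 i = pos k i.
  have [//|mv] := step_move st i.
  by case/existsP: na; exists (pos k.+1 i).
split=> //; apply: contra na => /existsP[w fw]; apply/existsP; exists w.
by rewrite -eq_pos; apply: leq_trans fw (step_flow st _ _).
Qed.

(* The delay of an agent is measured by lam = phi + time, frozen once the agent
   is inactive.  A move leaves lam unchanged, and an agent that has to wait is
   blocked by an agent whose lam is now smaller by exactly one; hence the
   values of lam exceeding M form a gapless chain. *)
Lemma delay_chain k : k <= K -> exists lam stop : 'I_n -> nat,
  [/\ forall i, lam i = phi (pos k i) + stop i /\ stop i <= k,
      forall i, active k i -> stop i = k,
      forall i j, stop i <= j <= k -> pos j i = pos k i &
      forall i, M < lam i -> exists j, (lam j).+1 = lam i].
Proof.
elim: k => [_|k IH lt_k].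
  exists (fun i => phi (xI i)), (fun=> 0); split=> [i|//|i j|i].
  - by rewrite pos0 addn0.
  - by rewrite leqn0 => /eqP->.
  - by rewrite ltnNge leq_bigmax.
have [lam [stop [lamE act_stop still chain]]] := IH (ltnW lt_k).
have st := stp lt_k; have tk := tightk (ltnW lt_k).
pose stop' i := if active k i then k.+1 else stop i.
pose lam' i := phi (pos k.+1 i) + stop' i.
have lam_inactive i : ~~ active k i -> lam' i = lam i.
  move=> na; rewrite /lam' /stop' (negPf na) (proj1 (inactive_stay lt_k na)).
  by rewrite (proj1 (lamE i)).
have lam_moved i : pos k.+1 i != pos k i -> lam' i = lam i.
  move=> ne; have [/eqP|mv] := step_move st i; first by rewrite (negPf ne).
  have act : active k i by apply/existsP; exists (pos k.+1 i).
  rewrite /lam' /stop' act (proj1 (lamE i)) (act_stop i act) (proj2 (tk _ _ mv)).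
  by rewrite addnS addSn.
have lam_wait i : active k i -> pos k.+1 i = pos k i ->
    lam' i = (lam i).+1 /\ exists j, (lam' j).+1 = lam' i.
  move=> act eq_i; have /existsP[w fw] := act.
  have [j fj] := step_blocked st eq_i fw; have [_ phij] := tk _ _ fj.
  split; first by rewrite /lam' /stop' act eq_i addnS (proj1 (lamE i)) (act_stop i act).
  exists j; rewrite /lam' /stop' act eq_i phij; case: ifP => [_|na]; first by lia.
  (* The blocker cannot have arrived, since flow enters its vertex. *)
  move/negbT in na; have [eq_j _] := inactive_stay lt_k na.
  have [_ in0] := inactive_goal (ltnW lt_k) na.
  by move: fj; rewrite eq_j in0.
have lamP i : lam' i = lam i \/ lam' i = (lam i).+1 /\ exists j, (lam' j).+1 = lam' i.
  have [na|act] := boolP (active k i); last by left; apply: lam_inactive.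
  have [/eqP eq_i|ne] := boolP (pos k.+1 i == pos k i); last by left; apply: lam_moved.
  by right; apply: lam_wait.
exists lam', stop'; split.
- move=> i; split=> //; rewrite /stop'; case: ifP => // _.
  by apply: leqW; case: (lamE i).
- move=> i act; rewrite /stop'; case: ifP => // /negbT na.
  by have [_] := inactive_stay lt_k na; rewrite act.
- move=> i j; rewrite /stop'; case: ifP => [_|/negbT na].
    by rewrite -eqn_leq => /eqP->.
  have [eq_i _] := inactive_stay lt_k na.
  move=> /andP[le_j]; rewrite leq_eqVlt => /predU1P[-> //|lt_j].
  by rewrite eq_i; apply: still; rewrite le_j.
(* If the old predecessor [j] of [i] had to wait, it now has the same lam as [i], and the blocker of
   [j] takes its place. *)
- move=> i; case: (lamP i) => [->|[_ ex_j] _ //].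
  move=> /chain[j eq_j]; case: (lamP j) => [eq_j'|[eq_j' [j2 eq_j2]]].
    by exists j; rewrite eq_j'.
  by exists j2; rewrite eq_j2 eq_j'.
Qed.

Lemma chain_bound (lam : 'I_n -> nat) m :
  (forall i, m < lam i -> exists j, (lam j).+1 = lam i) ->
  forall i, lam i < m + n.
Proof.
move=> chain i; have n_gt0 := ltn_ord i; rewrite ltnNge; apply/negP => le_i.
(* All values from [lam i] down to [m] are attained; if the bound failed, there would be at least n
   + 1 of them for n agents. *)
have down j : j <= lam i - m -> exists i', lam i' + j = lam i.
  elim: j => [_|j IH lt_j]; first by exists i; rewrite addn0.
  have [i' eq_i'] := IH (ltnW lt_j).
  have /chain[i2 eq_i2] : m < lam i' by lia.
  by exists i2; lia.
have down' (j : 'I_n.+1) : exists i', lam i' + j == lam i.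
  have [|i' <-] := down j; first by have := ltn_ord j; lia.
  by exists i'.
pose g (j : 'I_n.+1) := xchoose (down' j).
have g_inj : injective g.
  move=> j1 j2 eq_g; apply: val_inj => /=.
  have /eqP := xchooseP (down' j1); have /eqP := xchooseP (down' j2).
  by rewrite -/(g j1) -/(g j2) eq_g; lia.
by have := leq_card g g_inj; rewrite !card_ord ltnn.
Qed.

(** An active agent would have lam at least K, but the chain gives lam < M + n <= #|T| + n - 1 <=
    K. *)
Lemma all_inactive i : ~~ active K i.
Proof.
have [lam [stop [lamE act_stop _ chain]]] := delay_chain (leqnn K).
apply/negP => act; have := chain_bound chain i.
have [-> _] := lamE i; rewrite (act_stop i act).
have : M < #|T|.
  have n_gt0 : 0 < #|'I_n| by rewrite card_ord; apply: fcg_agents inst.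
  rewrite /M; have [i0 ->] := eq_bigmax (fun i => phi (xI i)) n_gt0; exact: phi_lt.
lia.
Qed.

Lemma pos_step k i : k < K ->
  pos k.+1 i = pos k i \/ e (pos k i) (pos k.+1 i) /\ phi (pos k i) = (phi (pos k.+1 i)).+1.
Proof.
move=> lt_k; have [->|mv] := step_move (stp lt_k) i; [by left|right].
exact: tightk (ltnW lt_k) _ _ mv.
Qed.

(** No vertex is visited again after being left; so an agent stays at its final vertex from the
    first visit on, as feasibility demands. *)
Lemma pos_descend k k' i : k <= k' <= K ->
  pos k' i = pos k i \/ phi (pos k' i) < phi (pos k i).
Proof.
move=> /andP[]; elim: k' => [|k' IH]; first by rewrite leqn0 => /eqP->; left.
rewrite leq_eqVlt => /predU1P[->|le_k lt_k']; first by left.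
have [->|[_ eq_phi]] := pos_step i lt_k'; first exact: IH le_k (ltnW lt_k').
by right; have [<-|] := IH le_k (ltnW lt_k'); lia.
Qed.

Let P i k := pos (minn k K) i.

Let P_lt i k : k <= K -> P i k = pos k i.
Proof. by rewrite /P => /minn_idPl->. Qed.

Let P_ge i k : K <= k -> P i k = pos K i.
Proof. by rewrite /P => /minn_idPr->. Qed.

Lemma P_step i k : P i k.+1 = P i k \/
  [/\ k < K, e (P i k) (P i k.+1) & phi (P i k) = (phi (P i k.+1)).+1].
Proof.
case: (ltnP k K) => le_k; last by left; rewrite !P_ge // leqW.
rewrite !P_lt //; last exact: ltnW.
by have [->|[]] := pos_step i le_k; [left|right].
Qed.

Lemma pos_stays i k k' : pos k i = pos K i -> k <= k' -> k <= K -> P i k' = pos K i.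
Proof.
move=> eq_k le_k le_K; case: (leqP k' K) => le_k'; last by rewrite P_ge // ltnW.
rewrite P_lt //; have [|->//|lt1] := @pos_descend k k' i; first by rewrite le_k.
have [|//|lt2] := @pos_descend k' K i; first by rewrite le_k' leqnn.
by move: lt1 lt2; rewrite eq_k; lia.
Qed.

(** The equality case of [lip_moves]: every move lowers [phi] by exactly one. *)
Lemma moves_exact i k : phi (xI i) = phi (P i k) + moves (P i) k.
Proof.
elim: k => [|k ->]; first by rewrite P_lt // pos0 addn0.
rewrite movesS; have [->|[_ _ eq_phi]] := P_step i k; first by rewrite eqxx addn0.
case: eqP => [eq_P|_]; last by lia.
by move: eq_phi; rewrite -eq_P; lia.
Qed.

(** The final vertices are distinct goals, so sending the goal of each agent to its final vertex and
    fixing all other vertices is injective. *)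
Lemma final_perm :
  exists2 s : {perm T}, perm_on [set xG i | i : 'I_n] s & forall i, s (xG i) = pos K i.
Proof.
have injG := fcg_injI inst.
have final i : pos K i \in codom xG by have [] := inactive_goal (leqnn K) (all_inactive i).
pose h x := if [pick i | xG i == x] is Some i then pos K i else x.
have hG i : h (xG i) = pos K i.
  rewrite /h; case: pickP => [j /eqP/(fcg_injG inst)-> //|/(_ i)]; by rewrite eqxx.
have hN x : x \notin codom xG -> h x = x.
  rewrite /h; case: pickP => // i /eqP<-; by rewrite codom_f.
have h_inj : injective h.
  move=> x y; have [/codomP[i ->]|nx] := boolP (x \in codom xG);
    have [/codomP[j ->]|ny] := boolP (y \in codom xG); rewrite ?hG ?hN //.
  - by move/(posk_inj (leqnn K))->.
  - by move=> eq_y; rewrite -eq_y final in ny.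
  - by move=> eq_x; rewrite eq_x final in nx.
exists (perm h_inj) => [|i]; last by rewrite permE.
apply/subsetP => x; rewrite inE permE; apply: contraR => nx; apply/eqP/hN.
by apply: contra nx => /codomP[i ->]; apply: imset_f.
Qed.

Lemma schedule_optimal : exists s : {perm T},
  [/\ forall i, s (xG i) = pos K i, distance_optimal e xI xG s P &
      exists2 c, convergence_time xG s P c & c <= n + max_dist e xI xG - 1].
Proof.
have [s on_s sG] := final_perm; exists s.
have ex_first i : exists k, P i k == pos K i by exists K; rewrite P_lt.
pose kmin i := ex_minn (ex_first i).
have first i : first_visit (P i) (s (xG i)) (kmin i).
  rewrite /kmin; case: ex_minnP => k /eqP eq_k min_k; split; rewrite sG //.
  by move=> j lt_j eq_j; have := min_k j; rewrite eq_j eqxx; lia.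
have kmin_le i k : pos k i = pos K i -> k <= K -> kmin i <= k.
  by move=> eq_k le_k; rewrite /kmin; case: ex_minnP => j _; apply; rewrite P_lt // eq_k.
have sol : solution e xI xG s P.
  split=> // [i|i j ne_ij [k]].
    split; first by rewrite P_lt.
    have le_K := kmin_le i K erefl (leqnn K); have [eq_i _] := first i.
    exists (kmin i); split=> // [k le_k|k _].
      by rewrite sG; apply: (pos_stays _ le_k le_K); rewrite -(P_lt i le_K) eq_i sG.
    by have [->|[]] := P_step i k; [right|left].
  have ne_P : P i k != P j k.
    by rewrite /P (inj_eq (posk_inj _)) // geq_minr.
  case=> [/eqP|[eq1 eq2]]; first by rewrite (negPf ne_P).
  (* In an exchange both agents move, so [phi] would drop along the edge in both directions. *)
  have [st_i|[_ _ phi_i]] := P_step i k; first by rewrite -eq2 st_i eqxx in ne_P.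
  have [st_j|[_ _ phi_j]] := P_step j k; first by rewrite eq1 st_j eqxx in ne_P.
  by move: phi_i phi_j; rewrite -eq1 eq2; lia.
split=> //.
  split=> //; exists (\sum_i moves (P i) K).
    by apply: total_distance_eq => i k le_k; rewrite !P_ge // leqW.
  move=> s' P' D' [on_s' feas' _] /total_distance_ge dist'.
  have [km hkm] : exists km : 'I_n -> nat, forall i,
      [/\ P' i 0 = xI i, P' i (km i) = s' (xG i),
          forall k, km i <= k -> P' i k = s' (xG i) &
          forall k, k < km i -> e (P' i k) (P' i k.+1) \/ P' i k = P' i k.+1].
    apply: (fin_all_exists (P := fun i km => [/\ P' i 0 = xI i, P' i km = s' (xG i),
          forall k, km <= k -> P' i k = s' (xG i) &
          forall k, k < km -> e (P' i k) (P' i k.+1) \/ P' i k = P' i k.+1])) => i.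
    by have [eq0 [km [[eq_km _] st mv]]] := feas' i; exists km; split.
  (* By this time every agent of the competing solution is at its goal. *)
  apply: leq_trans (dist' (\max_i km i)).
  (* Adding the potentials of the goals to both sides avoids truncated differences and absorbs the
     two permutations. *)
  suff : \sum_i phi (xG i) + \sum_i moves (P i) K
      <= \sum_i phi (xG i) + \sum_i moves (P' i) (\max_i km i) by rewrite leq_add2l.
  rewrite -{1}(sum_perm_on phi (fcg_injG inst) on_s).
  rewrite -(sum_perm_on phi (fcg_injG inst) on_s') -!big_split /=.
  apply: leq_sum => i _; have [eq0 _ stay mv] := hkm i.
  have -> : phi (s (xG i)) + moves (P i) K = phi (P' i 0).
    by rewrite eq0 (moves_exact i K) sG P_lt.
  rewrite -(stay (\max_i km i)) ?leq_bigmax //; apply: lip_moves lip _ => j _.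
  case: (ltnP j (km i)) => [/mv //|le_j]; right.
  by rewrite !stay // leqW.
exists (\max_i kmin i); first by exists kmin.
apply/bigmax_leqP => i _.
have [lam [stop [lamE _ still chain]]] := delay_chain (leqnn K).
have [eq_lam le_stop] := lamE i.
(* The agent rests from [stop i] on, and phi (goal) + stop < M + n. As M is attained at some start,
   the Lipschitz bound turns M - phi (goal) into a distance. *)
have : kmin i <= stop i by apply: kmin_le => //; apply: still; rewrite leqnn.
have := chain_bound chain i; rewrite eq_lam.
have [/codomP[j eq_j] _] := inactive_goal (leqnn K) (all_inactive i).
have n_gt0 : 0 < #|'I_n| by rewrite card_ord; apply: fcg_agents inst.
rewrite /M; have [i0 ->] := eq_bigmax (fun i => phi (xI i)) n_gt0.
have := lip_dist (fcg_connected inst (xI i0) (xG j)) lip; rewrite eq_j.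
have : dist e (xI i0) (xG j) <= max_dist e xI xG.
  apply: leq_trans (leq_bigmax (F := fun i => \max_j _) i0).
  exact: (leq_bigmax (F := fun j => dist e (xI i0) (xG j))).
have := fcg_agents inst; lia.
Qed.

End Schedule.

(** * Shortest path search in the residual graph *)

Section Dijkstra.
Variables (V : nat) (e : rel 'I_V) (phi us : 'I_V -> nat) (f : 'I_V -> 'I_V -> nat).
Implicit Types vis d par : 'I_V -> nat.

(* Distances are capped at V, which is harmless since unserved goals are closer
   than that; vis v is the rank at which v was visited, 0 if it was not. *)
Record search_inv k vis d par : Prop := SearchInv {
  si_card : #|[set v | 0 < vis v]| = k;
  si_vis : forall v, vis v <= k;
  si_cap : forall v, d v <= V;
  si_source : forall v, 0 < us v -> d v = 0;
  si_relaxed : forall v w, 0 < vis v -> e v w -> d w <= d v + rcost phi f v w;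
  si_mono : forall v w, 0 < vis v -> vis w = 0 -> d v <= d w;
  si_par : forall w, d w < V -> 0 < us w \/ exists v : 'I_V,
    [/\ par w = v, e v w, d w = d v + rcost phi f v w, 0 < vis v
      & 0 < vis w -> vis v < vis w]
}.

Lemma search_init vis d par : (forall v, vis v = 0) ->
  (forall v, d v = if 0 < us v then 0 else V) -> search_inv 0 vis d par.
Proof.
move=> vis0 dE; split=> [|v|v|v|v w|v w|w]; rewrite ?vis0 ?dE //.
- by apply/eqP; rewrite cards_eq0; apply/eqP/setP => v; rewrite !inE vis0.
- by case: ifP.
- by move->.
- by case: ifP => [_ _|]; [left | rewrite ltnn].
Qed.

(** Reduced costs are nonnegative and [x] is nearest among the unvisited, so relaxing from [x]
    changes no visited distance and leaves no unvisited one below [d x]. *)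
Lemma search_step k vis d par vis' d' par' (x : 'I_V) : irreflexive e ->
  search_inv k vis d par -> vis x = 0 -> (forall w, vis w = 0 -> d x <= d w) ->
  (forall v, vis' v = if v == x then k.+1 else vis v) ->
  (forall w, let b := e x w && (d x + rcost phi f x w < d w) in
     d' w = (if b then d x + rcost phi f x w else d w) /\
     par' w = if b then (x : nat) else par w) ->
  search_inv k.+1 vis' d' par'.
Proof.
move=> irr [card le_k cap src relx mono parE] visx min_x visE upE.
have fixed v : 0 < vis' v -> d' v = d v.
  rewrite visE (proj1 (upE v)); case: eqP => [->|_] vis_v; first by rewrite irr.
  case: ifP => // /andP[_]; have := mono _ _ vis_v visx; lia.
have le_d w : d' w <= d w by rewrite (proj1 (upE w)); case: ifP => // /andP[_ /ltnW].
have ge_d w : vis' w = 0 -> d x <= d' w.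
  rewrite visE (proj1 (upE w)); case: eqP => // _ visw; case: ifP => _; [lia | exact: min_x].
have visx' : 0 < vis' x by rewrite visE eqxx.
have vis_old v : 0 < vis v -> vis' v = vis v.
  by rewrite visE; case: eqP => // ->; rewrite visx.
split.
- rewrite -card -[RHS]add1n (_ : [set v | 0 < vis' v] = x |: [set v | 0 < vis v]).
    by rewrite cardsU1 inE visx.
  by apply/setP => v; rewrite !inE visE; case: eqP.
- by move=> v; rewrite visE; case: ifP => // _; apply: leqW.
- by move=> v; apply: leq_trans (le_d v) (cap v).
- by move=> v /src dv; have := le_d v; rewrite dv; lia.
- move=> v w vis_v vw; rewrite (fixed _ vis_v); move: vis_v; rewrite visE.
  case: eqP => [eq_v _|_ vis_v]; last exact: leq_trans (le_d w) (relx _ _ vis_v vw).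
  subst v; rewrite (proj1 (upE w)) vw /=; case: ltnP => //.
- move=> v w vis_v vis_w; rewrite (fixed _ vis_v).
  have le_v : d v <= d x by move: vis_v; rewrite visE; case: eqP => [->//|_ /mono]; apply.
  exact: leq_trans le_v (ge_d w vis_w).
- move=> w; have [b|nb] := boolP (e x w && (d x + rcost phi f x w < d w)).
    have [dw parw] := upE w; rewrite b in dw parw; move=> _; right; exists x.
    have /andP[xw lt_w] := b; split=> //; first by rewrite dw (fixed x).
    (* An improved vertex is unvisited, as visited distances are final; its rank condition is
       void. *)
    move=> vis_w; have := fixed _ vis_w; lia.
  have [dw parw] := upE w; rewrite (negPf nb) in dw parw; rewrite dw => lt_d.
  have [|[v [pw vw eq_d vis_v lt_v]]] := parE _ lt_d; [by left | right; exists v].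
  have vis_v' := vis_old _ vis_v.
  rewrite parw vis_v' fixed ?vis_v' //; split=> //; rewrite visE.
  (* The vertex [x] itself gets rank [k.+1], above the rank of its parent, which was visited
     before. *)
  by case: eqP => [_ _|_ /lt_v //]; rewrite ltnS.
Qed.

Lemma search_unvisited k vis d par : search_inv k vis d par -> k < V ->
  exists v, vis v = 0.
Proof.
move=> inv lt_k; have [/existsP[v /eqP]|] := boolP [exists v, vis v == 0]; first by exists v.
rewrite negb_exists => /forallP h; have := si_card inv.
rewrite (_ : [set v | 0 < vis v] = setT) ?cardsT ?card_ord; first by lia.
by apply/setP => v; rewrite !inE lt0n h.
Qed.

Lemma search_visited vis d par v : search_inv V vis d par -> 0 < vis v.
Proof.
move=> inv; have : v \in [set v | 0 < vis v]; last by rewrite inE.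
suff -> : [set v | 0 < vis v] = setT by rewrite inE.
by apply/eqP; rewrite eqEcard subsetT cardsT card_ord (si_card inv) /=.
Qed.

End Dijkstra.

(** * One greedy time step *)

Section Advance.
Variables (V n : nat) (e : rel 'I_V) (phi : 'I_V -> nat) (xG : 'I_n -> 'I_V).
Variables (x : 'I_n -> 'I_V) (g : 'I_V -> 'I_V -> nat) (nxt : 'I_n -> nat).
Hypotheses (x_inj : injective x) (tgt : tight e phi g).
Hypothesis nxtP : forall i, nxt i = V /\ (forall w, g (x i) w = 0) \/
  exists2 w : 'I_V, nxt i = w & 0 < g (x i) w.

(** Lexicographic order of level and index, as in the two nested loops; the level is that at the
    beginning of the time step. *)
Definition treated L i (j : 'I_n) := (phi (x j) < L) || ((phi (x j) == L) && (j < i)).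

(** [x] and [g] are positions and flow at the beginning of the step, [p] and [f] the current ones.
    [ai_row] holds because only the agent on a vertex uses up the flow leaving it, [ai_blocked]
    because a vertex that blocks a treated agent is not vacated later in the step. *)
Record advance_inv L i (p : 'I_n -> 'I_V) (f : 'I_V -> 'I_V -> nat) (occ : 'I_V -> nat)
    : Prop := AdvanceInv {
  ai_inj : injective p;
  ai_occ : forall v, (0 < occ v) = (v \in codom p);
  ai_bal : balanced xG f p;
  ai_flow : forall u w, f u w <= g u w;
  ai_pos : forall j, p j = x j \/
    [/\ treated L i j, nxt j = p j & 0 < g (x j) (p j)];
  ai_blocked : forall j, treated L i j -> p j = x j -> nxt j < V ->
    exists j', nxt j = p j';
  ai_row : forall j w, ~~ treated L i j -> f (x j) w = g (x j) w
}.

Lemma treated_next L j : treated L n j = treated L.+1 0 j.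
Proof. by rewrite /treated ltn_ord andbT andbF orbF ltnS orbC -leq_eqVlt. Qed.

Lemma treatedS L (i : 'I_n) j :
  treated L i.+1 j = treated L i j || ((phi (x j) == L) && (j == i)).
Proof.
have E : (j < i.+1) = (j < i) || (j == i) by rewrite ltnS leq_eqVlt orbC.
by rewrite /treated E; case: (_ < L); case: (_ == L); case: (_ < i); case: (_ == i).
Qed.

Lemma advance_next L p f occ : advance_inv L n p f occ -> advance_inv L.+1 0 p f occ.
Proof.
case=> h1 h2 h3 h4 h5 h6 h7; split=> // [j|j|j w]; rewrite -?treated_next.
- exact: h5.
- exact: h6.
- exact: h7.
Qed.

Lemma advance_init p f occ : p =1 x -> f =2 g -> balanced xG f p ->
  (forall v, (0 < occ v) = (v \in codom p)) -> advance_inv 0 0 p f occ.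
Proof.
move=> pE fE bal occE; split=> //.
- by move=> i j; rewrite !pE; apply: x_inj.
- by move=> u w; rewrite fE.
- by move=> j; left.
- by move=> j; rewrite /treated !ltn0 andbF.
Qed.

(** The program only sees the current vertex of an agent. One that has already moved came from a
    level below [L] and is now lower still, so it is not mistaken for an agent of level [L]. *)
Lemma advance_level L (i : 'I_n) p f occ : advance_inv L i p f occ ->
  (phi (p i) == L) = (phi (x i) == L).
Proof.
move=> inv; have [->//|[tr _ /tgt[_ eq_phi]]] := ai_pos inv i.
by move: tr; rewrite /treated ltnn andbF orbF; lia.
Qed.

Lemma advance_skip L (i : 'I_n) p f occ : advance_inv L i p f occ ->
  phi (x i) != L -> advance_inv L i.+1 p f occ.
Proof.
move=> inv ne; have tr j : treated L i.+1 j = treated L i j.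
  by rewrite treatedS; case: (j =P i) => [->|_]; rewrite ?(negPf ne) ?andbF orbF.
case: inv => h1 h2 h3 h4 h5 h6 h7.
by split=> // [j|j|j w]; rewrite tr; [apply: h5 | apply: h6 | apply: h7].
Qed.

(** This also covers an agent that has arrived: then [nxt i] is V and the condition on its target is
    void. *)
Lemma advance_wait L (i : 'I_n) p f occ : advance_inv L i p f occ ->
  phi (x i) = L -> (forall w : 'I_V, nxt i = w -> 0 < occ w) ->
  advance_inv L i.+1 p f occ.
Proof.
move=> [h1 h2 h3 h4 h5 h6 h7] eq_L wait; split=> //.
- move=> j; have [->|[tr q1 q2]] := h5 j; first by left.
  by right; rewrite treatedS tr.
- move=> j; rewrite treatedS => /orP[|/andP[_ /eqP->] _ lt_nxt]; first exact: h6.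
  have /codomP[j' eq_j'] : Ordinal lt_nxt \in codom p by rewrite -h2; apply: wait.
  by exists j'; rewrite -eq_j'.
- by move=> j w; rewrite treatedS negb_or => /andP[/h7].
Qed.

Lemma advance_move L (i : 'I_n) p f occ p' f' occ' (w : 'I_V) :
  advance_inv L i p f occ -> phi (x i) = L -> nxt i = w -> occ w = 0 ->
  (forall j, p' j = if j == i then w else p j) ->
  (forall u v, f u v = f' u v + ((u == x i) && (v == w))) ->
  (forall v, occ' v = if v == w then 1 else if v == x i then 0 else occ v) ->
  advance_inv L i.+1 p' f' occ'.
Proof.
move=> [h1 h2 h3 h4 h5 h6 h7] eq_L nxt_i occ_w pE fE occE.
have gw : 0 < g (x i) w.
  have [[eq_V _]|[w' eq_w']] := nxtP i; first by have := ltn_ord w; lia.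
  by rewrite (_ : w = w') //; apply: val_inj => /=; rewrite -nxt_i.
have [_ phi_w] := tgt gw.
have p_i : p i = x i.
  by have [//|[]] := h5 i; rewrite /treated eq_L !ltnn andbF.
have w_free : w \notin codom p by rewrite -h2 occ_w.
have ne_w : x i != w by apply: contraNneq w_free => <-; rewrite -p_i codom_f.
have w_x : (w == x i) = false by rewrite eq_sym; apply: negPf.
have mem_p' v : (v \in codom p') = (v == w) || (v != x i) && (v \in codom p).
  apply/codomP/orP => [[j ->]|[/eqP->|/andP[ne /codomP[j eq_v]]]].
  - rewrite pE; case: (j =P i) => [_|/eqP ne]; first by left; rewrite eqxx.
    by right; rewrite codom_f andbT -p_i (inj_eq h1).
  - by exists i; rewrite pE eqxx.
  - exists j; rewrite pE; case: (j =P i) => // eq_j.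
    by move: ne; rewrite eq_v eq_j p_i eqxx.
split.
- move=> j1 j2; rewrite !pE; case: (j1 =P i) => [->|_]; case: (j2 =P i) => [->|_] //.
  + by move=> eq_w; move: w_free; rewrite eq_w codom_f.
  + by move=> eq_w; move: w_free; rewrite -eq_w codom_f.
  + exact: h1.
- move=> v; rewrite occE mem_p'; case: eqP => //= _; case: eqP => //= _; exact: h2.
(* The vertex [x i] loses a unit of outflow together with its agent; [w] loses a unit of inflow and
   gains an agent. *)
- move=> v; have := h3 v.
  rewrite (outflow_incr v fE) (inflow_incr v fE) mem_p'.
  move: (nat_of_bool (v \in codom xG)) => isG.
  have [->|ne1] := eqVneq v w.
    rewrite (negPf w_free) w_x; lia.
  have [->|ne2] := eqVneq v (x i); last by rewrite /= !addn0.
  by rewrite -p_i codom_f /=; lia.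
- by move=> u v; apply: leq_trans (h4 u v); rewrite fE leq_addr.
- move=> j; rewrite pE treatedS; case: eqP => [->|_].
    by right; split=> //; rewrite eq_L !eqxx orbT.
  by have [->|[tr q1 q2]] := h5 j; [left | right; rewrite tr].
- move=> j; rewrite pE treatedS; case: (j =P i) => [-> _ eq_w|_].
    by rewrite eq_w eqxx in ne_w.
  rewrite andbF orbF => tr eq_j lt_nxt.
  have [j' eq_j'] := h6 j tr eq_j lt_nxt.
  exists j'; rewrite pE; case: (j' =P i) => // eq_i.
  have [[eq_V _]|[w' eq_w' gw']] := nxtP j; first by rewrite eq_V ltnn in lt_nxt.
  have [_ phi_j] := tgt gw'.
  (* If [i] were the blocker of [j], then [j] would lie at level L + 1 and could not have had its
     turn. *)
  have : phi w' = L.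
    by rewrite -eq_L -p_i -eq_i; congr phi; apply: val_inj; rewrite /= -eq_w'.
  by move: tr; rewrite /treated; lia.
- move=> j v; rewrite treatedS negb_or => /andP[tr ne].
  rewrite -(h7 j v tr) fE; case: (x j =P x i) => [/x_inj eq_j|_]; last by rewrite addn0.
  by move: ne; rewrite eq_j eq_L !eqxx.
Qed.

Lemma advance_flow_step p f occ : (forall v, phi v < V) -> advance_inv V 0 p f occ ->
  flow_step g f x p.
Proof.
move=> phi_lt [h1 h2 h3 h4 h5 h6 h7].
have tr j : treated V 0 j by rewrite /treated phi_lt.
split=> // [j|j w eq_j gw].
  by have [->|[_ _ gj]] := h5 j; [left | right].
have [[_ g0]|[w' eq_w' gw']] := nxtP j; first by rewrite g0 in gw.
have [|j' eq_j'] := h6 j (tr j) eq_j; first by rewrite eq_w'.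
by exists j'; rewrite (_ : p j' = w') //; apply: val_inj; rewrite /= -eq_w'.
Qed.

End Advance.

(** * The program *)

Arguments run : simpl never.

Lemma runE :
  (forall s, run Skip s = s) *
  (forall r x s, run (Assign r x) s = setv r (eval s x) s) *
  (forall a x y s, run (Put a x y) s = put a (eval s x) (eval s y) s) *
  (forall x y s, run (Out x y) s = out (eval s x) (eval s y) s) *
  (forall c1 c2 s, run (Seq c1 c2) s = run c2 (run c1 s)) *
  (forall x y c1 c2 s,
     run (IfLt x y c1 c2) s = if eval s x < eval s y then run c1 s else run c2 s).
Proof. by []. Qed.

Local Infix ";;" := Seq (at level 61, right associativity).

Local Notation rV := 2 (only parsing).
Local Notation rn := 3 (only parsing).
Local Notation rq := 4 (only parsing).
Local Notation rW := 5 (only parsing).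
Local Notation rh := 6 (only parsing).
Local Notation rk := 7 (only parsing).
Local Notation rv := 8 (only parsing).
Local Notation rm := 9 (only parsing).
Local Notation rx := 10 (only parsing).
Local Notation rc := 11 (only parsing).
Local Notation rw := 12 (only parsing).
Local Notation rg := 13 (only parsing).
Local Notation rj := 14 (only parsing).
Local Notation rp := 15 (only parsing).
Local Notation ri := 16 (only parsing).
Local Notation rL := 17 (only parsing).
Local Notation rr := 18 (only parsing).

(* aROW u = u * V; aPOS i is the position of agent i and aOCC marks the occupied
   vertices; aUS and aUG mark the starts and goals not yet served by the flow aF,
   a matrix in row-major order; aPHI is the potential; aVIS, aD and aPAR hold the
   rank, distance and parent in the shortest path search; aNXT i is the vertex
   agent i heads for, or V if it has arrived. *)
Local Notation aROW := 0 (only parsing).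
Local Notation aPOS := 1 (only parsing).
Local Notation aUS := 2 (only parsing).
Local Notation aOCC := 3 (only parsing).
Local Notation aUG := 4 (only parsing).
Local Notation aVIS := 5 (only parsing).
Local Notation aD := 6 (only parsing).
Local Notation aPAR := 7 (only parsing).
Local Notation aPHI := 8 (only parsing).
Local Notation aF := 9 (only parsing).
Local Notation aNXT := 10 (only parsing).

Definition flow_at u w := Arr aF (Plus (Arr aROW (Var u)) (Var w)).
Definition put_flow u w x := Put aF (Plus (Arr aROW (Var u)) (Var w)) x.

(* The raw area, of size 4 V^2 + 2, has room for the input and for the output block. *)
Definition load_sizes :=
  Assign rV (Raw (Cst 0)) ;;
  Assign rn (Raw (Cst 1)) ;;
  For rv rV (Assign rq (Plus (Var rq) (Var rV))) ;;
  Assign rW (Plus (Var rV) (Var rV)) ;;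
  Assign rB (Plus (Cst 2) (Plus (Plus (Var rq) (Var rq)) (Plus (Var rq) (Var rq)))).

Definition load_rows :=
  For rv rV (Put aROW (Var rv) (Var rr) ;; Assign rr (Plus (Var rr) (Var rV))).

Definition load_agents :=
  For ri rn
    (Assign rx (Raw (Plus (Cst 2) (Plus (Var rq) (Var ri)))) ;;
     Assign rp (Raw (Plus (Cst 2) (Plus (Var rq) (Plus (Var rn) (Var ri))))) ;;
     Put aPOS (Var ri) (Var rx) ;;
     Put aUS (Var rx) (Cst 1) ;;
     Put aOCC (Var rx) (Cst 1) ;;
     Put aUG (Var rp) (Cst 1)).

Definition init_dist :=
  For rv rV
    (Put aVIS (Var rv) (Cst 0) ;;
     IfLt (Cst 0) (Arr aUS (Var rv)) (Put aD (Var rv) (Cst 0)) (Put aD (Var rv) (Var rV))).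

(** The comparison is strict, so the initial value of [rm] is a sentinel. [select] needs V + 1,
    since distances may equal the cap V; for [target] V is enough, as some unserved goal is
    closer. *)
Definition argmin x y r :=
  For rv rV
    (IfLt x y
       (IfLt (Arr aD (Var rv)) (Var rm)
          (Assign rm (Arr aD (Var rv)) ;; Assign r (Var rv)) Skip) Skip).

Definition select :=
  Assign rm (Plus (Cst 1) (Var rV)) ;; argmin (Arr aVIS (Var rv)) (Cst 1) rx.

Definition new_dist :=
  IfLt (Cst 0) (flow_at rw rx)
    (Assign rc (Arr aD (Var rx)))
    (Assign rc (Plus (Arr aD (Var rx))
       (Minus (Plus (Cst 1) (Arr aPHI (Var rw))) (Arr aPHI (Var rx))))).

Definition relax :=
  For rw rV
    (IfLt (Cst 0) (Raw (Plus (Cst 2) (Plus (Arr aROW (Var rx)) (Var rw))))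
       (new_dist ;;
        IfLt (Var rc) (Arr aD (Var rw))
          (Put aD (Var rw) (Var rc) ;; Put aPAR (Var rw) (Var rx)) Skip) Skip).

Definition search :=
  init_dist ;;
  For rk rV (select ;; Put aVIS (Var rx) (Plus (Cst 1) (Var rk)) ;; relax).

Definition target :=
  Assign rm (Var rV) ;; argmin (Cst 0) (Arr aUG (Var rv)) rg.

(** [rm] still holds the distance of the goal found by [target]. *)
Definition raise :=
  For rv rV (Put aPHI (Var rv) (Plus (Arr aPHI (Var rv)) (Minus (Var rm) (Arr aD (Var rv))))).

(** With counted loops only, the walk takes V turns and idles once it has reached an unserved
    start. *)
Definition walk_back :=
  For rj rV
    (IfLt (Cst 0) (Arr aUS (Var rw)) Skip
       (Assign rp (Arr aPAR (Var rw)) ;;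
        IfLt (Cst 0) (flow_at rw rp)
          (put_flow rw rp (Minus (flow_at rw rp) (Cst 1)))
          (put_flow rp rw (Plus (Cst 1) (flow_at rp rw))) ;;
        Assign rw (Var rp))).

Definition augment :=
  Assign rw (Var rg) ;; walk_back ;; Put aUS (Var rw) (Cst 0) ;; Put aUG (Var rg) (Cst 0).

Definition phase := search ;; target ;; raise ;; augment.

Definition optimise := For rh rn phase.

(** The recorded horizon is 2 V - 1, so each agent takes up 2 V cells and the offset of agent i is
    twice the tabulated i * V; the entry exists because n <= V. *)
Definition record_cell k :=
  Plus (Plus (Plus (Cst 1) (Var rn)) (Plus (Arr aROW (Var ri)) (Arr aROW (Var ri)))) k.

(** This overwrites parts of the input, which is harmless: the adjacency matrix is read only by the
    search, and from here on the flow is enough. *)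
Definition record_positions :=
  For ri rn (Out (record_cell (Var rk)) (Arr aPOS (Var ri))).

Definition scan_flow :=
  For rw rV (IfLt (Cst 0) (flow_at rp rw) (Put aNXT (Var ri) (Var rw)) Skip).

Definition choose_targets :=
  For ri rn
    (Put aNXT (Var ri) (Var rV) ;; Assign rp (Arr aPOS (Var ri)) ;; scan_flow).

Definition try_move :=
  Assign rp (Arr aPOS (Var ri)) ;;
  Assign rx (Arr aNXT (Var ri)) ;;
  IfLt (Arr aPHI (Var rp)) (Var rL) Skip
    (IfLt (Var rL) (Arr aPHI (Var rp)) Skip
       (IfLt (Var rx) (Var rV)
          (IfLt (Cst 0) (Arr aOCC (Var rx)) Skip
             (put_flow rp rx (Minus (flow_at rp rx) (Cst 1)) ;;
              Put aOCC (Var rp) (Cst 0) ;;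
              Put aOCC (Var rx) (Cst 1) ;;
              Put aPOS (Var ri) (Var rx))) Skip)).

(* Agents of lower layers go first: they may vacate the vertices that the others enter. *)
Definition advance := For rL rV (For ri rn try_move).

Definition time_step := record_positions ;; choose_targets ;; advance.

(* rW holds 2 V, and all agents have stopped by time n + l - 1 < 2 V. *)
Definition simulate := For rk rW time_step.

Definition write_goals :=
  Out (Cst 0) (Minus (Var rW) (Cst 1)) ;;
  For ri rn
    (Out (Plus (Cst 1) (Var ri)) (Raw (record_cell (Minus (Var rW) (Cst 1))))).

Definition algorithm :=
  load_sizes ;; load_rows ;; load_agents ;; optimise ;; simulate ;; write_goals.

Lemma algorithm_ok : cmd_ok algorithm.
Proof. by []. Qed.

Definition sizes_env V n : nat -> nat := fun r =>
  if r == rV then V else if r == rn then n else if r == rW then V + V else 0.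

(** Separated from [load_sizes], which assigns the registers used as loop limits; only afterwards
    are they constant, as [time_cost] requires. *)
Definition main_loop :=
  load_rows ;; load_agents ;; optimise ;; simulate ;; write_goals.

(** * Verification of the shortest path search *)

Section Correctness.
Variables (V n : nat) (e : rel 'I_V) (xI xG : 'I_n -> 'I_V).
Hypothesis inst : fcg_instance e xI xG.

Definition base s :=
  [/\ var s rV = V, var s rn = n, var s rW = V + V,
      2 + (V * V + V * V + (V * V + V * V)) = var s rB
    & forall u, u < V -> arr s aROW u = u * V].

Definition adjacency s := forall u w : 'I_V, ram s (2 + (u * V + w)) = e u w.

Definition fl s (u w : 'I_V) := arr s aF (u * V + w).

Definition keeps c :=
  [&& rB \notin mods c, rV \notin mods c, rn \notin mods c, rW \notin mods c
    & aROW \notin amods c].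

Lemma idx_eq (u u' w w' : 'I_V) : (u * V + w == u' * V + w') = (u == u') && (w == w').
Proof.
apply/eqP/andP => [|[/eqP-> /eqP->]//] eq_idx.
have V_gt0 : 0 < V by apply: leq_trans (ltn_ord u).
have eq_u : u = u' :> nat.
  have := congr1 (fun x => x %/ V) eq_idx.
  by rewrite !divnMDl // !divn_small // !addn0.
by split; apply/eqP/val_inj => //=; move: eq_idx; rewrite eq_u => /addnI.
Qed.

Lemma idx_lt (u w : 'I_V) : u * V + w < V * V.
Proof. by have := ltn_ord u; have := ltn_ord w; nia. Qed.

Lemma base_frame c s s' : keeps c -> frame c s s' -> base s -> base s'.
Proof.
move=> /and5P[hB hV hn hW hR] [fv fa _] [bV bn bW bB brow].
by split; rewrite ?(fv rV) ?(fv rn) ?(fv rW) ?(fv rB) // => u lt_u; rewrite fa // brow.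
Qed.

Lemma base_setv r v s : r \notin [:: rB; rV; rn; rW] -> base s -> base (setv r v s).
Proof.
rewrite !inE !negb_or => /and4P[hB hV hn hW] [bV bn bW bB brow].
rewrite /base /= /upd ![_ == r]eq_sym (negPf hB) (negPf hV) (negPf hn) (negPf hW).
by split=> // u lt_u; rewrite arr_setv ?brow.
Qed.

Lemma adjacency_frame c s s' : keeps c -> ~~ outs c -> frame c s s' -> base s ->
  adjacency s -> adjacency s'.
Proof.
move=> /and5P[hB _ _ _ _] ho [_ _ fr] [_ _ _ bB _] adj u w.
by rewrite fr // -bB; have := idx_lt u w; lia.
Qed.

Lemma ord_ltS m k (lt_k : k < m) (w : 'I_m) : w < k.+1 -> w = Ordinal lt_k \/ w < k.
Proof.
by rewrite ltnS leq_eqVlt => /predU1P[eq_w|]; [left; apply: val_inj | right].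
Qed.

Lemma argmin_spec x y r s (b : pred 'I_V) :
  cmd_ok (argmin x y r) -> keeps (argmin x y r) -> r \notin [:: rv; rm] ->
  base s ->
  (forall s' (v : 'I_V), frame (argmin x y r) s s' -> var s' rv = v ->
     (eval s' x < eval s' y) = b v) ->
  let s' := run (argmin x y r) s in
  (forall w, b w -> var s' rm <= arr s aD w) /\
  (var s' rm = var s rm \/
   exists g : 'I_V, [/\ var s' r = g, b g & arr s aD g = var s' rm]).
Proof.
move=> ok kp nr bs hb; have [bV _ _ _ _] := bs.
have rvm : (rm == r = false) * (rv == r = false) * (r == rv = false).
  by move: nr; rewrite !inE negb_or => /andP[/negPf h1 /negPf h2]; rewrite ![_ == r]eq_sym h1 h2.
pose I k s' := (forall w : 'I_V, w < k -> b w -> var s' rm <= arr s aD w) /\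
  (var s' rm = var s rm \/
   exists g : 'I_V, [/\ var s' r = g, b g & arr s aD g = var s' rm]).
have : I (var s rV) (run (argmin x y r) s); last first.
  by rewrite bV => -[h1 h2]; split=> // w; apply: h1.
apply: for_rule => //; first by split=> //; left.
move=> k s' lt_k fr eq_k [h1 h2]; rewrite bV in lt_k.
pose v := Ordinal lt_k.
have bv := hb s' v fr eq_k.
have /and5P[hB _ _ _ _] := kp.
have dE i : arr s' aD i = arr s aD i by apply: (frame_arr fr).
rewrite !runE bv; case: ifP => [bvT|bvF].
  rewrite /= eq_k dE -[k]/(v : nat); case: ifP => [lt_d|ge_d].
    split; last by right; exists v; rewrite /= /upd /= ?rvm eqxx ?rvm.
    move=> w /(ord_ltS lt_k)[-> _|lt_w /(h1 w lt_w)]; rewrite /= /upd /= ?rvm //=.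
    exact: leq_trans (ltnW lt_d).
  split; last by rewrite /= /upd /= rvm.
  move=> w /(ord_ltS lt_k)[-> _|lt_w /(h1 w lt_w)] //.
  by rewrite /= /upd /= leqNgt -[k]/(v : nat) ge_d.
split; last by rewrite /= /upd /= rvm.
move=> w /(ord_ltS lt_k)[->|lt_w /(h1 w lt_w)] //.
by rewrite bvF.
Qed.

Lemma init_dist_spec s : base s ->
  let s' := run init_dist s in
  forall v : 'I_V, arr s' aVIS v = 0 /\ arr s' aD v = if 0 < arr s aUS v then 0 else V.
Proof.
move=> bs; have [bV _ _ _ _] := bs.
pose I k s' := forall v : 'I_V, v < k ->
  arr s' aVIS v = 0 /\ arr s' aD v = if 0 < arr s aUS v then 0 else V.
suff : I (var s rV) (run init_dist s) by rewrite bV => h s' v; apply: h.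
apply: for_rule => // k s' lt_k fr eq_k Ik v.
have usE i : arr s' aUS i = arr s aUS i by apply: (frame_arr fr).
have sV : var s' rV = V by rewrite (frame_var fr).
rewrite bV in lt_k; rewrite !runE /= eq_k sV arr_put //= usE => /(ord_ltS lt_k)[->|lt_v].
  by case: ifP => _; rewrite !(arr_put, arr_setv) //= eqxx.
have ne : (v == k :> nat) = false by lia.
by case: ifP => _; rewrite !(arr_put, arr_setv) //= ne; apply: Ik.
Qed.

Lemma select_spec s : base s -> (forall v : 'I_V, arr s aD v <= V) ->
  (exists v : 'I_V, arr s aVIS v = 0) ->
  exists x : 'I_V, [/\ var (run select s) rx = x, arr s aVIS x = 0 &
    forall w : 'I_V, arr s aVIS w = 0 -> arr s aD x <= arr s aD w].
Proof.
move=> bs cap [v0 vis0]; have [bV _ _ _ _] := bs.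
rewrite /select !runE; set s0 := setv _ _ s.
have bs0 : base s0 by apply: base_setv.
have [|h] := @argmin_spec (Arr aVIS (Var rv)) (Cst 1) rx s0
  (fun v => arr s aVIS v == 0) isT isT isT bs0.
  by move=> s' v fr eq_v; rewrite /= eq_v ltnS leqn0 (frame_arr fr) // arr_setv.
case=> [|[x [ex /eqP vx dx]]]; first move=> hm.
  have m0 : var s0 rm = V.+1 by rewrite /s0 /= bV.
  rewrite m0 in hm.
  by have := h v0; rewrite vis0 eqxx hm => /(_ isT); rewrite arr_setv //; have := cap v0; lia.
exists x; split=> // w visw; have := h w; rewrite visw eqxx => /(_ isT).
by rewrite -dx !arr_setv.
Qed.

Lemma relax_spec s (x : 'I_V) : base s -> adjacency s -> var s rx = x ->
  let c w := arr s aD x + rcost (fun v : 'I_V => arr s aPHI v) (fl s) x w in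
  let b w := e x w && (c w < arr s aD w) in
  let s' := run relax s in
  forall w : 'I_V, arr s' aD w = (if b w then c w else arr s aD w) /\
    arr s' aPAR w = if b w then (x : nat) else arr s aPAR w.
Proof.
move=> bs adj eq_x c b; have [bV _ _ _ _] := bs.
pose I k s' := forall w : 'I_V,
  arr s' aD w = (if (w < k) && b w then c w else arr s aD w) /\
  arr s' aPAR w = if (w < k) && b w then (x : nat) else arr s aPAR w.
suff : I (var s rV) (run relax s).
  by rewrite bV => h s' w; have := h w; rewrite ltn_ord.
apply: for_rule => // k s' lt_k fr eq_k Ik w; rewrite bV in lt_k.
have bs' : base s' by apply: (base_frame _ fr bs).
have adj' : adjacency s' by apply: (adjacency_frame _ _ fr bs adj).
have sx : var s' rx = x by rewrite (frame_var fr).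
have [_ _ _ _ row'] := bs'; have [_ _ _ _ row] := bs.
pose kv := Ordinal lt_k.
have eE : ram s' (2 + (arr s' aROW x + k)) = e x kv by rewrite row' ?ltn_ord // (adj' x kv).
have fE : arr s' aF (arr s' aROW k + x) = fl s kv x.
  by rewrite row' // (frame_arr fr).
have phiE i : arr s' aPHI i = arr s aPHI i by apply: (frame_arr fr).
(* G has no loops, so the distance of [x], read in every turn, does not change. *)
have bx : b x = false by rewrite /b (fcg_irrefl inst).
have dx : arr s' aD x = arr s aD x by have [-> _] := Ik x; rewrite bx andbF.
have dk : arr s' aD k = arr s aD k.
  by have [-> _] := Ik kv; rewrite ltnn.
have nk w' : w' != kv -> (w' < k.+1) = (w' < k).
  by move=> ne; rewrite ltnS leq_eqVlt -[k]/(val kv) val_eqE (negPf ne).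
have e1 : run new_dist s' = setv rc (c kv) s'.
  rewrite /new_dist !runE /= sx eq_k fE /c /rcost; case: ifP => _; rewrite ?addn0 dx //.
  by rewrite !phiE add1n.
rewrite /new_dist !runE in e1; rewrite !runE e1 /= sx eq_k eE; case ek : (e x kv) => /=; last first.
  rewrite !arr_setv //; have [->|/nk->] := eqVneq w kv; last exact: Ik.
  by have [-> ->] := Ik kv; rewrite /b ek !andbF.
rewrite !arr_setv // dk; have [->|ne] := eqVneq w kv; last first.
  rewrite (nk _ ne); have ne' : (w == k :> nat) = false by apply: negPf ne.
  by case: ifP => _; rewrite !(arr_setv, arr_put) //= ne'; apply: Ik.
rewrite /= ltnS leqnn /b ek /=; case: ifP => _; rewrite !(arr_setv, arr_put) //= ?eqxx //.
by have [-> ->] := Ik kv; rewrite ltnn.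
Qed.

Definition pot s (v : 'I_V) := arr s aPHI v.
Definition searched k s s' :=
  search_inv e (pot s) (fun v : 'I_V => arr s aUS v) (fl s) k
    (fun v : 'I_V => arr s' aVIS v) (fun v : 'I_V => arr s' aD v)
    (fun v : 'I_V => arr s' aPAR v).

Lemma search_spec s : base s -> adjacency s -> searched V s (run search s).
Proof.
move=> bs adj; rewrite /search runE; set s0 := run init_dist s.
have fr0 : frame init_dist s s0 by apply: run_frame.
have bs0 : base s0 by apply: (base_frame _ fr0 bs).
have adj0 : adjacency s0 by apply: (adjacency_frame _ _ fr0 bs adj).
have [bV _ _ _ _] := bs0.
rewrite -{1}bV; apply: (for_rule (I := fun k s' => searched k s s')) => //.
  apply: search_init => v; rewrite arr_setv //; first by have [] := init_dist_spec bs v.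
  by have [_] := init_dist_spec bs v.
move=> k s1 lt_k fr1 eq_k inv; rewrite bV in lt_k.
have bs1 : base s1 by apply: (base_frame _ fr1 bs0).
have adj1 : adjacency s1 by apply: (adjacency_frame _ _ fr1 bs0 adj0).
have [x [eq_x visx min_x]] := select_spec bs1 (si_cap inv) (search_unvisited inv lt_k).
rewrite !runE; set s2 := run select s1 in eq_x *.
have fr2 : frame select s1 s2 by apply: run_frame.
set s3 := put aVIS _ _ s2.
have e3 : s3 = put aVIS x k.+1 s2.
  by rewrite /s3 /= eq_x (frame_var fr2) // eq_k add1n.
have fr3 : frame (Put aVIS (Var rx) (Plus (Cst 1) (Var rk))) s2 s3.
  exact: (@run_frame (Put aVIS (Var rx) (Plus (Cst 1) (Var rk))) s2).
have bs2 : base s2 by apply: (base_frame _ fr2 bs1).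
have bs3 : base s3 by apply: (base_frame _ fr3 bs2).
have adj2 : adjacency s2 by apply: (adjacency_frame _ _ fr2 bs1 adj1).
have adj3 : adjacency s3 by apply: (adjacency_frame _ _ fr3 bs2 adj2).
have fr4 : frame relax s3 (run relax s3) by apply: run_frame.
have keep a i : a \notin [:: aVIS; aD; aPAR] -> a < 16 -> arr s3 a i = arr s a i.
  rewrite !inE !negb_or => /and3P[n1 n2 n3] lt_a.
  rewrite e3 arr_put // (negPf n1) (frame_arr fr2) // (frame_arr fr1) ?(frame_arr fr0) //;
    by rewrite !inE ?(negPf n1) ?(negPf n2) ?(negPf n3).
have keep1 a i : a < 16 -> a != aVIS -> arr s3 a i = arr s1 a i.
  by move=> lt_a ne; rewrite e3 arr_put // (negPf ne) (frame_arr fr2).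
have rcE : rcost (pot s3) (fl s3) x =1 rcost (pot s) (fl s) x.
  by move=> w; rewrite /rcost /pot /fl !keep.
have x3 : var s3 rx = x by rewrite e3 eq_x.
have := relax_spec bs3 adj3 x3; cbv zeta => rel.
apply: search_step (fcg_irrefl inst) inv visx min_x _ _ => [v|w].
  by rewrite arr_setv // (frame_arr fr4) // e3 arr_put //= (frame_arr fr2).
by have := rel w; rewrite !arr_setv // -/(pot s3) rcE !keep1.
Qed.

End Correctness.

(** * Verification of the flow augmentations *)

Section Optimise.
Variables (V n : nat) (e : rel 'I_V) (xI xG : 'I_n -> 'I_V).
Hypothesis inst : fcg_instance e xI xG.

Notation base := (base V n).
Notation adjacency := (adjacency e).
Notation searched := (searched e).

(* extra and extra' are nonzero only while a path is being augmented backwards: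
   they are then the indicators of its goal and of the vertex reached so far. *)
Definition conserved s (extra extra' : 'I_V -> nat) := forall v,
  outflow (fl s) v + (v \in codom xG) + arr s aUS v + extra v =
  inflow (fl s) v + (v \in codom xI) + arr s aUG v + extra' v.

(** [m] counts the goals served so far. [pi_goal] keeps unserved goals within reach of the capped
    search; [pi_zero] bounds the final potential below V, as G is connected. *)
Record phase_inv m s : Prop := PhaseInv {
  pi_base : base s;
  pi_adj : adjacency s;
  pi_lip : lipschitz e (pot s);
  pi_tight : tight e (pot s) (@fl V s);
  pi_us : forall v : 'I_V, arr s aUS v <= 1;
  pi_ug : forall v : 'I_V, arr s aUG v <= 1;
  pi_conserved : conserved s (fun=> 0) (fun=> 0);
  pi_goal : forall v : 'I_V, 0 < arr s aUG v -> pot s v = 0;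
  pi_zero : exists v : 'I_V, pot s v = 0;
  pi_sum_us : \sum_(v : 'I_V) arr s aUS v + m = n;
  pi_sum_ug : \sum_(v : 'I_V) arr s aUG v + m = n
}.

Lemma sum_pos (F : 'I_V -> nat) : 0 < \sum_v F v -> exists v, 0 < F v.
Proof.
rewrite lt0n sum_nat_eq0 negb_forall => /existsP[v]; rewrite -lt0n => Fv.
by exists v.
Qed.

Lemma sum_clear (F : 'I_V -> nat) (w : 'I_V) :
  \sum_v (if v == w then 0 else F v) + F w = \sum_v F v.
Proof.
rewrite (bigD1 w) //= eqxx add0n [RHS](bigD1 w) //= addnC; congr addn.
by apply: eq_bigr => v /negPf->.
Qed.

Lemma raise_spec s (v : 'I_V) : base s ->
  pot (run raise s) v = pot s v + (var s rm - arr s aD v).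
Proof.
move=> bs; have [bV _ _ _ _] := bs.
pose I k s' := forall v : 'I_V,
  pot s' v = if v < k then pot s v + (var s rm - arr s aD v) else pot s v.
suff h : I (var s rV) (run raise s) by rewrite (h v) bV ltn_ord.
apply: for_rule => // k s' lt_k fr eq_k Ik w; rewrite bV in lt_k.
have mE : var s' rm = var s rm by apply: (frame_var fr).
have dE i : arr s' aD i = arr s aD i by apply: (frame_arr fr).
rewrite !runE /= eq_k /pot arr_setv // arr_put // mE dE /=.
have [/(ord_ltS lt_k)[->|lt_w]|ge_w] := boolP (w < k.+1).
- by have := Ik (Ordinal lt_k); rewrite /pot /= ltnn eqxx => ->.
- by have := Ik w; rewrite /pot lt_w => ->; have -> : (w == k :> nat) = false by lia.
- have := Ik w; rewrite /pot; have -> : (w == k :> nat) = false by lia.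
  by have -> : (w < k) = false by lia.
Qed.

Section WalkBack.
Variables (s : store) (g : 'I_V) (D : nat).
Hypotheses (bs : base s) (tgt : tight e (pot s) (@fl V s)).
Hypothesis vis_pos : forall v : 'I_V, 0 < arr s aVIS v <= V.
Hypothesis parP : forall w : 'I_V, arr s aD w <= D -> 0 < arr s aUS w \/
  exists v : 'I_V, [/\ arr s aPAR w = v, e v w,
    if 0 < fl s w v then pot s w = (pot s v).+1 else pot s v = (pot s w).+1,
    arr s aD v <= D & arr s aVIS v < arr s aVIS w].
Hypotheses (g_D : arr s aD g <= D) (g_rw : var s rw = g).
Hypothesis cons : conserved s (fun=> 0) (fun=> 0).

Lemma walk_back_spec : let s' := run walk_back s in
  exists w : 'I_V, [/\ var s' rw = w, 0 < arr s aUS w, tight e (pot s) (@fl V s') &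
    conserved s' (fun v => v == g) (fun v => v == w)].
Proof.
have [bV _ _ _ row] := bs.
(* The rank of the current vertex falls in each turn, so V turns suffice; distances would not do, as
   arcs may have length 0. By the last clause the flow between vertices of at most the current rank
   is still that of the search, so the arc to the parent is read as the search saw it. *)
pose I k s' := exists w : 'I_V, [/\ var s' rw = w /\ arr s aD w <= D,
  0 < arr s aUS w \/ arr s aVIS w + k <= V,
  tight e (pot s) (@fl V s'),
  conserved s' (fun v => v == g) (fun v => v == w) &
  forall a b : 'I_V, arr s aVIS a <= arr s aVIS w -> arr s aVIS b <= arr s aVIS w ->
    fl s' a b = fl s a b].
suff : I (var s rV) (run walk_back s).
  rewrite bV => -[w [[w_rw w_D] [us_w|]]]; first by exists w.
  by have /andP[vw _] := vis_pos w; lia.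
apply: for_rule => //.
  exists g; split=> //.
    by right; have /andP[_] := vis_pos g; lia.
  by move=> v; have := cons v; rewrite !addn0 => eq_v; congr (_ + _).
move=> k s' lt_k fr eq_k [w [[w_rw w_D] dec tgt' cons' keep]]; rewrite bV in lt_k.
have bs' : base s' by apply: (base_frame _ fr bs).
have [_ _ _ _ row'] := bs'.
have arrE a i : a != aF -> a < 16 -> arr s' a i = arr s a i.
  by move=> ne lt_a; apply: (frame_arr fr) => //; rewrite !inE negb_or ne.
rewrite !runE /= w_rw (arrE aUS) //; case: ifP => us_w.
  by exists w; split=> //; left.
have [|[v [par_w vw arc v_D lt_v]]] := parP w_D; first by rewrite us_w.
rewrite !arr_setv // !(arrE aPAR) // par_w !row' //.
rewrite -/(fl s' w v) -/(fl s' v w).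
have eq_f : fl s' w v = fl s w v by apply: keep => //; apply: ltnW.
have dec' : 0 < arr s aUS v \/ arr s aVIS v + k.+1 <= V.
  by right; case: dec => [|le_k]; [rewrite us_w | lia].
rewrite eq_f; case: ifP arc => fwv phiE.
  set s2 := setv _ _ _.
  have flE a b : fl s' a b = fl s2 a b + ((a == w) && (b == v)).
    rewrite /fl /s2 !arr_setv // arr_put // arr_setv // idx_eq /=.
    case: andP => [[/eqP-> /eqP->]|_]; last by rewrite addn0.
    by rewrite -/(fl s' w v) eq_f subn1 addn1 prednK.
  have us2 i : arr s2 aUS i = arr s' aUS i by rewrite /s2 !arr_setv // arr_put.
  have ug2 i : arr s2 aUG i = arr s' aUG i by rewrite /s2 !arr_setv // arr_put.
  exists v; split=> //.
  - move=> a b fab; apply: tgt'; rewrite flE; lia.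
  - move=> x; have := cons' x; rewrite (outflow_incr x flE) (inflow_incr x flE) us2 ug2.
    by move: (nat_of_bool (x == v)) (nat_of_bool (x == w)) => p q; lia.
  - move=> a b le_a le_b; rewrite -(keep a b); try lia.
    by rewrite flE; case: eqP => [eq_a|_]; [rewrite eq_a in le_a; lia | rewrite addn0].
set s2 := setv _ _ _.
have flE a b : fl s2 a b = fl s' a b + ((a == v) && (b == w)).
  rewrite /fl /s2 !arr_setv // arr_put // arr_setv // idx_eq /=.
  case: andP => [[/eqP-> /eqP->]|_]; last by rewrite addn0.
  by rewrite -/(fl s' v w) addnC.
have us2 i : arr s2 aUS i = arr s' aUS i by rewrite /s2 !arr_setv // arr_put.
have ug2 i : arr s2 aUG i = arr s' aUG i by rewrite /s2 !arr_setv // arr_put.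
exists v; split=> //.
- move=> a b; rewrite flE; case: andP => [[/eqP-> /eqP->] _|_]; first by [].
  by rewrite addn0 => /tgt'.
- move=> x; have := cons' x; rewrite (outflow_incr x flE) (inflow_incr x flE) us2 ug2.
  by move: (nat_of_bool (x == v)) (nat_of_bool (x == w)) => p q; lia.
- move=> a b le_a le_b; rewrite -(keep a b); try lia.
  by rewrite flE; case: (b =P w) => [eq_b|_]; [rewrite eq_b in le_b; lia | rewrite andbF addn0].
Qed.

End WalkBack.

Lemma phase_step m s : m < n -> phase_inv m s -> phase_inv m.+1 (run phase s).
Proof.
move=> lt_m [bs adj lip tgt us1 ug1 cons goal _ sum_us sum_ug].
have e_sym := fcg_sym inst; have conn := fcg_connected inst.
have [u0 us_u0] : exists u : 'I_V, 0 < arr s aUS u.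
  by apply: (@sum_pos (fun v => arr s aUS v)); rewrite -(ltn_add2r m) add0n sum_us.
have [g0 ug_g0] : exists u : 'I_V, 0 < arr s aUG u.
  by apply: (@sum_pos (fun v => arr s aUG v)); rewrite -(ltn_add2r m) add0n sum_ug.
pose s1 := run search s; pose s2 := run target s1; pose s3 := run raise s2.
pose s4 := setv rw (var s3 rg) s3; pose s5 := run walk_back s4.
pose s6 := put aUS (var s5 rw) 0 s5; pose s7 := put aUG (var s6 rg) 0 s6.
have -> : run phase s = s7 by [].
have inv : searched V s s1 by apply: (search_spec inst bs adj).
have fr1 : frame search s s1 by apply: run_frame.
have bs1 : base s1 by apply: (base_frame _ fr1 bs).
have adj1 : adjacency s1 by apply: (adjacency_frame _ _ fr1 bs adj).
have vis_pos (v : 'I_V) : 0 < arr s1 aVIS v <= V.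
  by rewrite (search_visited v inv) (si_vis inv).
have relx v w := si_relaxed inv (w := w) (search_visited v inv).
have frt : frame target s1 s2 by apply: run_frame.
have [g [eq_g ug_g d_g d_lt min_g]] : exists g : 'I_V, [/\ var s2 rg = g,
    0 < arr s aUG g, arr s1 aD g = var s2 rm, arr s1 aD g < V &
    forall w : 'I_V, 0 < arr s aUG w -> var s2 rm <= arr s1 aD w].
  rewrite /s2 /target !runE; set s0 := setv _ _ s1.
  have bs0 : base s0 by apply: base_setv.
  have [|h] := @argmin_spec V n (Cst 0) (Arr aUG (Var rv)) rg s0
    (fun v => 0 < arr s aUG v) isT isT isT bs0.
    by move=> s' v fr eq_v; rewrite /= eq_v (frame_arr fr) // arr_setv // (frame_arr fr1).
  (* Some unserved goal beats the sentinel V of [target]. *)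
  have d_g0 : arr s1 aD g0 < V.
    have := relaxed_lt lip tgt relx (conn u0 g0) (si_source inv us_u0) (goal _ ug_g0).
    by rewrite card_ord.
  have := h g0 ug_g0; rewrite arr_setv // => le_m.
  case=> [eq_m|[g [eq_g ug_g d_g]]].
    by have [bV _ _ _ _] := bs1; move: le_m; rewrite eq_m /s0 /= bV; lia.
  rewrite arr_setv // in d_g; exists g; split=> //; first by rewrite d_g; lia.
have bs2 : base s2 by apply: (base_frame _ frt bs1).
have adj2 : adjacency s2 by apply: (adjacency_frame _ _ frt bs1 adj1).
have frr : frame raise s2 s3 by apply: run_frame.
have potE (v : 'I_V) : pot s3 v = pot s v + (arr s1 aD g - arr s1 aD v).
  by rewrite (raise_spec _ bs2) /pot d_g !(frame_arr frt) // (frame_arr fr1).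
have bs3 : base s3 by apply: (base_frame _ frr bs2).
have adj3 : adjacency s3 by apply: (adjacency_frame _ _ frr bs2 adj2).
have arr3 a i : a < 16 -> a != aPHI -> arr s3 a i = arr s1 a i.
  move=> lt_a ne; rewrite (frame_arr frr) // ?inE // (frame_arr frt) //.
have arr30 a i : a < 16 -> a \notin [:: aVIS; aD; aPAR; aPHI] -> arr s3 a i = arr s a i.
  rewrite !inE !negb_or => lt_a /and4P[n1 n2 n3 n4]; rewrite arr3 // (frame_arr fr1) //.
  by rewrite !inE (negPf n1) (negPf n2) (negPf n3).
have lip3 : lipschitz e (pot s3).
  by move=> u v uv; rewrite !potE; apply: (raise_lip (arr s1 aD g) lip tgt relx).
have flE u v : fl s3 u v = fl s u v by rewrite /fl arr30.
have tgt3 : tight e (pot s3) (@fl V s3).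
  by move=> u v; rewrite flE !potE; apply: (raise_tight (arr s1 aD g) e_sym tgt relx).
have e4 : s4 = setv rw g s3 by rewrite /s4 /= (frame_var frr) // eq_g.
have bs4 : base s4 by rewrite e4; apply: base_setv.
have adj4 : adjacency s4 by rewrite e4.
have arr4 a i : arr s4 a i = arr s3 a i by rewrite e4 arr_setv.
have cons4 : conserved s4 (fun=> 0) (fun=> 0).
  move=> v; have := cons v.
  have fl4 u w : fl s4 u w = fl s u w by rewrite /fl arr4 arr30.
  rewrite /outflow /inflow !arr4 !arr30 // => eq_v.
  rewrite (eq_bigr (fun w => fl s v w)) // [in RHS](eq_bigr (fun w => fl s w v)) //.
have [|||||w [eq_w us_w tgt5 cons5]] :=
  @walk_back_spec s4 g (arr s1 aD g) bs4 _ _ _ _ _ cons4.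
- by move=> u v; rewrite /fl /pot !arr4; apply: tgt3.
- by move=> v; rewrite arr4 arr3.
- move=> w; rewrite arr4 arr3 // => le_d.
  have [us_w|[v [par_w vw eq_d _ lt_v]]] := si_par inv (leq_ltn_trans le_d d_lt).
    by left; rewrite arr4 arr30.
  right; exists v; rewrite /pot /fl !arr4 -/(pot s3 w) -/(pot s3 v) -/(fl s3 w v) flE !arr3 //.
  split=> //; last by apply: lt_v; have /andP[] := vis_pos w.
    rewrite !potE.
    exact: (raise_arc (d := fun v : 'I_V => arr s1 aD v) lip tgt vw eq_d le_d).
  by apply: leq_trans le_d; rewrite eq_d leq_addr.
- by rewrite arr4 arr3.
- by rewrite e4.
rewrite -/s5 in eq_w tgt5 cons5.
have frw : frame walk_back s4 s5 by apply: run_frame.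
have bs5 : base s5 by apply: (base_frame _ frw bs4).
have adj5 : adjacency s5 by apply: (adjacency_frame _ _ frw bs4 adj4).
have g_s6 : var s6 rg = g by rewrite /s6 /= (frame_var frw) // e4 /= (frame_var frr).
have arr7 a i : a < 16 -> arr s7 a i =
    if (a == aUG) && (i == g) then 0 else if (a == aUS) && (i == w) then 0 else arr s5 a i.
  by move=> lt_a; rewrite /s7 g_s6 /s6 eq_w !arr_put.
have arr50 a i : a < 16 -> a \notin [:: aVIS; aD; aPAR; aPHI; aF] -> arr s5 a i = arr s a i.
  rewrite !inE !negb_or => lt_a /and5P[n1 n2 n3 n4 n5].
  rewrite (frame_arr frw) ?arr4 ?arr30 // !inE ?negb_or ?n1 ?n2 ?n3 ?n4 //.
  by rewrite n5.
have pot7 v : pot s7 v = pot s3 v by rewrite /pot arr7 //= (frame_arr frw) // arr4.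
have us7 (v : 'I_V) : arr s7 aUS v = if v == w then 0 else arr s aUS v.
  by rewrite arr7 //= arr50.
have ug7 (v : 'I_V) : arr s7 aUG v = if v == g then 0 else arr s aUG v.
  by rewrite arr7 //= arr50.
have fl7 u v : fl s7 u v = fl s5 u v by rewrite /fl arr7.
have us_w1 : arr s aUS w = 1.
  by move: us_w; rewrite arr4 arr30 //; have := us1 w; lia.
have ug_g1 : arr s aUG g = 1 by have := ug1 g; lia.
have pot_g : pot s7 g = 0 by rewrite pot7 potE goal // subnn.
split.
- have [bV bn bW bB row] := bs5; split=> // u lt_u.
  by rewrite arr7 //= row.
- move=> u v; rewrite /s7 ram_put; last first.
    by have [_ _ _ <- _] := bs5; have := idx_lt u v; lia.
  by rewrite /s6 ram_put //; have [_ _ _ <- _] := bs5; have := idx_lt u v; lia.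
- by move=> u v; rewrite !pot7; apply: lip3.
- move=> u v; rewrite !pot7 fl7 => /tgt5; rewrite /pot !arr4 //.
- by move=> v; rewrite us7; case: ifP.
- by move=> v; rewrite ug7; case: ifP.
- move=> v; have := cons5 v.
  have -> : outflow (fl s5) v = outflow (fl s7) v by apply: eq_bigr => x _; rewrite fl7.
  have -> : inflow (fl s5) v = inflow (fl s7) v by apply: eq_bigr => x _; rewrite fl7.
  have us_v : arr s7 aUS v + (v == w) = arr s5 aUS v.
    by rewrite us7 arr50 //; case: eqP => [->|_]; rewrite ?us_w1 ?addn0.
  have ug_v : arr s7 aUG v + (v == g) = arr s5 aUG v.
    by rewrite ug7 arr50 //; case: eqP => [->|_]; rewrite ?ug_g1 ?addn0.
  rewrite -us_v -ug_v; move: (nat_of_bool (v == w)) (nat_of_bool (v == g)) => x y; lia.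
(* The goal just served was a nearest one, so no other unserved goal is raised. *)
- move=> v; rewrite ug7 pot7 potE; case: eqP => // _ ug_v.
  by rewrite goal //; have := min_g v ug_v; rewrite d_g; lia.
- by exists g.
- rewrite -sum_us -(sum_clear (fun v : 'I_V => arr s aUS v) w) us_w1 -addnA add1n.
  by congr (_ + _); apply: eq_bigr => v _; rewrite us7.
- rewrite -sum_ug -(sum_clear (fun v : 'I_V => arr s aUG v) g) ug_g1 -addnA add1n.
  by congr (_ + _); apply: eq_bigr => v _; rewrite ug7.
Qed.

Lemma optimise_spec s : phase_inv 0 s -> phase_inv n (run optimise s).
Proof.
move=> inv0; have [_ bn _ _ _] := pi_base inv0.
rewrite -[X in phase_inv X]bn; apply: for_rule => //; first by case: inv0.
move=> k s' lt_k _ _ inv; rewrite bn in lt_k.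
have : phase_inv k.+1 (run phase s') by apply: phase_step.
by case.
Qed.

End Optimise.

(** * Verification of the simulation *)

Section Simulate.
Variables (V n : nat) (e : rel 'I_V) (xI xG : 'I_n -> 'I_V).
Hypothesis inst : fcg_instance e xI xG.
Variable phi : 'I_V -> nat.
Hypothesis phi_lt : forall v, phi v < V.

Notation base := (base V n).

Lemma agents_le : n <= V.
Proof. by have := leq_card xI (fcg_injI inst); rewrite !card_ord. Qed.

(** The default [xI i] only makes the function total; [sm_pos] excludes it. *)
Definition posn s (i : 'I_n) : 'I_V := insubd (xI i) (arr s aPOS i).

Lemma posnE s (i : 'I_n) : arr s aPOS i < V -> arr s aPOS i = posn s i.
Proof. by move=> lt_p; rewrite /posn val_insubd lt_p. Qed.

Record sim_inv s : Prop := SimInv {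
  sm_base : base s;
  sm_pot : forall v, pot s v = phi v;
  sm_pos : forall i : 'I_n, arr s aPOS i < V;
  sm_inj : injective (posn s);
  sm_occ : forall v : 'I_V, (0 < arr s aOCC v) = (v \in codom (posn s));
  sm_bal : balanced xG (@fl V s) (posn s);
  sm_tight : tight e phi (@fl V s)
}.

Definition record_addr i k := 1 + n + (i * V + i * V) + k.

Lemma record_addr_lt s i k : base s -> i < n -> k < V + V -> record_addr i k < var s rB.
Proof. by move=> [_ _ _ <- _] lt_i lt_k; have := agents_le; rewrite /record_addr; nia. Qed.

Lemma record_addr_inj i i' k k' : k < V + V -> k' < V + V ->
  record_addr i k = record_addr i' k' -> i = i' /\ k = k'.
Proof.
rewrite /record_addr => lt_k lt_k' eq_a.
have eq_i : i = i'.
  have V2 : 0 < V + V by lia.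
  have : (i * (V + V) + k) %/ (V + V) = (i' * (V + V) + k') %/ (V + V).
    by congr (_ %/ _); lia.
  by rewrite !divnMDl // !divn_small // !addn0.
by split=> //; rewrite eq_i in eq_a; lia.
Qed.

Lemma record_spec s : base s -> var s rk < V + V ->
  let s' := run record_positions s in
  (forall i : 'I_n, ram s' (record_addr i (var s rk)) = arr s aPOS i) /\
  (forall j, (forall i : 'I_n, j != record_addr i (var s rk)) -> ram s' j = ram s j).
Proof.
move=> bs lt_k; have [_ bn _ _ row] := bs.
pose I m s' := (forall i : 'I_n, i < m -> ram s' (record_addr i (var s rk)) = arr s aPOS i) /\
  (forall j, (forall i : 'I_n, j != record_addr i (var s rk)) -> ram s' j = ram s j).
suff : I (var s rn) (run record_positions s).
  by rewrite bn => -[h1 h2]; split=> // i; apply: h1.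
apply: for_rule => // m s' lt_m fr eq_m [h1 h2]; rewrite bn in lt_m.
have bs' : base s' by apply: (base_frame _ fr bs).
have [_ bn' _ _ row'] := bs'.
have lt_mV : m < V by apply: leq_trans lt_m agents_le.
have kE : var s' rk = var s rk by apply: (frame_var fr).
rewrite !runE /= eq_m bn' row' // kE -/(record_addr m (var s rk)).
have lt_a := record_addr_lt bs' lt_m lt_k.
have pE : arr s' aPOS m = arr s aPOS m by apply: (frame_arr fr).
split=> [i /(ord_ltS lt_m)[->|lt_i]|j ne_j] /=; rewrite ram_out //.
- by rewrite eqxx pE.
- case: eqP => [eq_a|_]; last exact: h1.
  by have [] := record_addr_inj lt_k lt_k eq_a; lia.
- by have := ne_j (Ordinal lt_m) => /= /negPf->; apply: h2.
Qed.

Lemma scan_spec s (i : 'I_n) (v : 'I_V) : base s -> var s ri = i -> var s rp = v ->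
  arr s aNXT i = V ->
  let s' := run scan_flow s in
  (arr s' aNXT i = V /\ (forall w, fl s v w = 0) \/
   exists2 w : 'I_V, arr s' aNXT i = w & 0 < fl s v w) /\
  (forall j : nat, j != i -> arr s' aNXT j = arr s aNXT j).
Proof.
move=> bs eq_i eq_v nxt_i; have [bV _ _ _ _] := bs.
pose I m s' :=
  (arr s' aNXT i = V /\ (forall w : 'I_V, w < m -> fl s v w = 0) \/
   exists2 w : 'I_V, arr s' aNXT i = w & 0 < fl s v w) /\
  (forall j : nat, j != i -> arr s' aNXT j = arr s aNXT j).
suff : I (var s rV) (run scan_flow s).
  by rewrite bV => -[[[h1 h1']|h1] h2]; split=> //; [left; split=> // w; apply: h1' | right].
apply: for_rule => //; first by split=> //; left.
move=> m s' lt_m fr eq_m [h1 h2]; rewrite bV in lt_m.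
have bs' : base s' by apply: (base_frame _ fr bs).
have [_ _ _ _ row'] := bs'.
have i' : var s' ri = i by rewrite (frame_var fr).
have v' : var s' rp = v by rewrite (frame_var fr).
have flE : arr s' aF (arr s' aROW v + m) = fl s v (Ordinal lt_m).
  by rewrite row' // (frame_arr fr).
rewrite !runE /= i' v' eq_m flE; case: ifP => fvm.
  split=> [|j ne_j]; last by rewrite arr_setv // arr_put //= (negPf ne_j) h2.
  by right; exists (Ordinal lt_m); rewrite // arr_setv // arr_put //= eqxx.
split=> // ; case: h1 => [[nV h1]|h1]; last by right.
left; split=> // w /(ord_ltS lt_m)[->|]; last exact: h1.
by apply/eqP; rewrite -leqn0 leqNgt fvm.
Qed.

Lemma choose_spec s : base s -> (forall i : 'I_n, arr s aPOS i < V) ->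
  let s' := run choose_targets s in
  forall i : 'I_n, arr s' aNXT i = V /\ (forall w, fl s (posn s i) w = 0) \/
    exists2 w : 'I_V, arr s' aNXT i = w & 0 < fl s (posn s i) w.
Proof.
move=> bs lt_pos; have [_ bn _ _ _] := bs.
pose I m s' := forall i : 'I_n, i < m ->
  arr s' aNXT i = V /\ (forall w, fl s (posn s i) w = 0) \/
  exists2 w : 'I_V, arr s' aNXT i = w & 0 < fl s (posn s i) w.
suff : I (var s rn) (run choose_targets s) by rewrite bn => h s' i; apply: h.
apply: for_rule => // m s' lt_m fr eq_m Im; rewrite bn in lt_m.
have bs' : base s' by apply: (base_frame _ fr bs).
have [bV' _ _ _ _] := bs'.
pose s1 := setv rp (arr s' aPOS m) (put aNXT m V s').
have -> : run (Put aNXT (Var ri) (Var rV) ;; Assign rp (Arr aPOS (Var ri)) ;; scan_flow) s'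
    = run scan_flow s1.
  by rewrite !(runE.1) /= eq_m bV' /s1 arr_put.
have fr1 : frame (Seq (Put aNXT (Var ri) (Var rV)) (Assign rp (Arr aPOS (Var ri)))) s' s1.
  have := @run_frame (Seq (Put aNXT (Var ri) (Var rV)) (Assign rp (Arr aPOS (Var ri)))) s' isT.
  by rewrite !runE /= eq_m bV' /s1 arr_put.
have bs1 : base s1 by apply: (base_frame _ fr1 bs').
have posE : arr s' aPOS m = posn s (Ordinal lt_m).
  by rewrite -posnE // (frame_arr fr).
have flE u w : fl s1 u w = fl s u w by rewrite /fl (frame_arr fr1) // (frame_arr fr).
have [|||h1 h2] := @scan_spec s1 (Ordinal lt_m) (posn s (Ordinal lt_m)) bs1.
- by rewrite /s1 /= eq_m.
- by rewrite /s1 /= posE.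
- by rewrite /s1 arr_setv // arr_put //= eqxx.
move=> i /(ord_ltS lt_m)[->|lt_i]; rewrite arr_setv //.
  case: h1 => [[nV h1]|[w nw fw]]; [left|right]; last by exists w => //; rewrite -flE.
  by split=> // w; rewrite -flE.
have ne_i : (i : nat) != m by lia.
by rewrite h2 // /s1 arr_setv // arr_put //= (negPf ne_i); apply: Im.
Qed.

Section AdvanceProg.
Variable s : store.
Let x := posn s.
Let g := @fl V s.
Let nxt (i : 'I_n) := arr s aNXT i.
Hypothesis x_inj : injective x.
Hypothesis tgt : tight e phi g.
Hypothesis nxtP : forall i, nxt i = V /\ (forall w, g (x i) w = 0) \/
  exists2 w : 'I_V, nxt i = w & 0 < g (x i) w.

Definition advance_state L i s' := [/\ base s', forall v, pot s' v = phi v,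
  forall i : 'I_n, arr s' aPOS i < V, forall i : 'I_n, arr s' aNXT i = nxt i &
  advance_inv phi xG x g nxt L i (posn s') (@fl V s') (fun v : 'I_V => arr s' aOCC v)].

Lemma try_move_spec L (i : 'I_n) s' : advance_state L i s' -> var s' ri = i ->
  var s' rL = L -> advance_state L i.+1 (run try_move s').
Proof.
move=> [bs' potE lt_pos nxtE inv] i' L'; have [bV _ _ _ row'] := bs'.
have lvl := advance_level tgt inv.
rewrite /try_move !(runE.1) !runE /= i' !arr_setv // posnE // -/(pot s' (posn s' i)).
rewrite potE L' bV nxtE; set s1 := setv rx _ _.
have keep i1 : advance_inv phi xG x g nxt L i1 (posn s') (@fl V s')
    (fun v : 'I_V => arr s' aOCC v) -> advance_state L i1 s1.
  by move=> inv1; split=> // [|j]; rewrite ?/s1 ?arr_setv //; do 2 apply: base_setv => //.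
have [eq_L|ne_L] := eqVneq (phi (x i)) L; last first.
  have skip := keep _ (advance_skip inv ne_L).
  by move: lvl; rewrite (negPf ne_L); case: ltngtP.
have {lvl} -> : phi (posn s' i) = L by apply/eqP; rewrite lvl eq_L.
rewrite ltnn; case: ifP => [lt_nxt|ge_nxt]; last first.
  apply: keep; apply: advance_wait inv eq_L _ => w eq_w.
  by move: ge_nxt; rewrite eq_w ltn_ord.
have [w eq_w] : exists w : 'I_V, nxt i = w by exists (Ordinal lt_nxt).
rewrite eq_w.
case: ifP => [occ_w|free_w].
  apply: keep; apply: advance_wait inv eq_L _ => w' eq_w'.
  by rewrite /= -eq_w' eq_w.
have occ_w : arr s' aOCC w = 0 by apply/eqP; rewrite -leqn0 leqNgt free_w.
have xi_pos : posn s' i = x i.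
  by have [//|[]] := ai_pos inv i; rewrite /treated eq_L !ltnn andbF.
have gw : 0 < g (x i) w.
  have [[eq_V _]|[w' eq_w']] := nxtP i; first by rewrite eq_V ltnn in lt_nxt.
  by rewrite (_ : w = w') //; apply: val_inj; rewrite /= -eq_w.
have unt : ~~ treated phi x L i i by rewrite /treated eq_L !ltnn andbF.
(* Agent [i] has not had its turn, so the flow by which it chose [w] is still there. *)
have flw : fl s' (posn s' i) w = g (x i) w by rewrite xi_pos (ai_row inv).
rewrite xi_pos in flw *.
rewrite row' // -/(fl s' (x i) w) flw.
set s2 := put aPOS _ _ _.
have arr2 a j : a < 16 -> arr s2 a j =
    if (a == aPOS) && (j == i :> nat) then w : nat
    else if (a == aOCC) && (j == w :> nat) then 1
    else if (a == aOCC) && (j == x i :> nat) then 0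
    else if (a == aF) && (j == x i * V + w) then g (x i) w - 1 else arr s' a j.
  by move=> lt_a; rewrite /s2 !arr_put // /s1 !arr_setv.
have bs2 : base s2.
  have [? ? ? ? row] := bs'; split=> // u lt_u.
  by rewrite arr2 //= row.
have lt_pos2 (j : 'I_n) : arr s2 aPOS j < V by rewrite arr2 //=; case: ifP.
split=> //.
- by move=> v; rewrite /pot arr2 //= -potE.
- by move=> j; rewrite arr2 //= nxtE.
- apply: (advance_move (w := w) x_inj tgt nxtP inv eq_L eq_w occ_w).
  + move=> j; apply: val_inj; rewrite /= -posnE // arr2 //= -val_eqE /=.
    by case: ifP => // _; rewrite posnE.
  + move=> u v; rewrite [fl s2 u v]/fl arr2 //= idx_eq; case: andP => [[/eqP-> /eqP->]|_].
      by rewrite flw subn1 addn1 prednK.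
    by rewrite addn0.
  + by move=> v; rewrite arr2.
Qed.

Lemma advance_spec : advance_state 0 0 s -> advance_state V 0 (run advance s).
Proof.
move=> inv0; have [[bV _ _ _ _] _ _ _ _] := inv0.
rewrite -[X in advance_state X]bV.
apply: (for_rule (I := fun L s' => advance_state L 0 s')) => //.
move=> L s1 lt_L fr1 eq_L inv1; have [[_ bn _ _ _] _ _ _ _] := inv1.
suff : advance_state L n (run (For ri rn try_move) s1).
  by case=> ? ? ? ? inv; split=> //; apply: advance_next inv.
rewrite -[X in advance_state _ X]bn.
apply: (for_rule (I := fun i s' => advance_state L i s')) => //.
move=> i s2 lt_i fr2 eq_i inv2; rewrite bn in lt_i.
have : advance_state L i.+1 (run try_move s2).
  by apply: (@try_move_spec L (Ordinal lt_i)) => //; rewrite (frame_var fr2).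
by case.
Qed.

End AdvanceProg.

Lemma sim_inv_setv r v s : r \notin [:: rB; rV; rn; rW] -> sim_inv s -> sim_inv (setv r v s).
Proof.
move=> nr [bs potE lt_pos inj occ bal tgt].
have arrE a i : arr (setv r v s) a i = arr s a i.
  by rewrite arr_setv //; move: nr; rewrite inE negb_or => /andP[].
have posE i : posn (setv r v s) i = posn s i by rewrite /posn arrE.
have codE u : (u \in codom (posn (setv r v s))) = (u \in codom (posn s)).
  by congr (_ \in _); apply: eq_codom.
have flE u w : fl (setv r v s) u w = fl s u w by rewrite /fl arrE.
split=> [|u|i|i j|u|u|u w]; rewrite /pot ?arrE ?posE ?codE ?flE //.
- exact: base_setv.
- by rewrite -/(pot s u).
- exact: inj.
- have -> : outflow (@fl V (setv r v s)) u = outflow (@fl V s) u by apply: eq_bigr => w _.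
  have -> : inflow (@fl V (setv r v s)) u = inflow (@fl V s) u by apply: eq_bigr => w _.
  exact: bal.
- exact: tgt.
Qed.

Lemma time_step_spec s k : sim_inv s -> var s rk = k -> k < V + V ->
  let s' := run time_step s in
  [/\ sim_inv s', flow_step (@fl V s) (@fl V s') (posn s) (posn s'),
      forall i : 'I_n, ram s' (record_addr i k) = posn s i &
      forall j, j < var s rB -> (forall i : 'I_n, j != record_addr i k) ->
        ram s' j = ram s j].
Proof.
move=> [bs potE lt_pos inj occ bal tgt] eq_k lt_k; rewrite -eq_k in lt_k *.
have [rec1 rec2] := record_spec bs lt_k.
have fr1 : frame record_positions s (run record_positions s) by apply: run_frame.
rewrite /time_step !(runE.1).
set s1 := run record_positions s in rec1 rec2 fr1 *.
have bs1 : base s1 by apply: (base_frame _ fr1 bs).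
have arr1 a i : a < 16 -> arr s1 a i = arr s a i.
  by move=> lt_a; apply: (frame_arr fr1).
have lt_pos1 (i : 'I_n) : arr s1 aPOS i < V by rewrite arr1.
have pos1 i : posn s1 i = posn s i by rewrite /posn arr1.
have nxt2 := choose_spec bs1 lt_pos1.
have fr2 : frame choose_targets s1 (run choose_targets s1) by apply: run_frame.
set s2 := run choose_targets s1 in nxt2 fr2 *.
have bs2 : base s2 by apply: (base_frame _ fr2 bs1).
have arr2 a i : a < 16 -> a != aNXT -> arr s2 a i = arr s a i.
  by move=> lt_a ne; rewrite (frame_arr fr2) ?arr1 // !inE negb_or ne.
have pos2 i : posn s2 i = posn s i by rewrite /posn arr2.
have fl2 u w : fl s2 u w = fl s u w by rewrite /fl arr2.
have inj2 : injective (posn s2) by move=> i j; rewrite !pos2; apply: inj.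
have tgt2 : tight e phi (@fl V s2) by move=> u w; rewrite fl2; apply: tgt.
have cod2 u : (u \in codom (posn s2)) = (u \in codom (posn s)).
  by congr (_ \in _); apply: eq_codom.
have bal2 : balanced xG (@fl V s2) (posn s2).
  move=> u; rewrite cod2.
  have -> : outflow (@fl V s2) u = outflow (@fl V s) u by apply: eq_bigr => w _.
  have -> : inflow (@fl V s2) u = inflow (@fl V s) u by apply: eq_bigr => w _.
  exact: bal.
have nxtP2 (i : 'I_n) : arr s2 aNXT i = V /\ (forall w, fl s2 (posn s2 i) w = 0) \/
    exists2 w : 'I_V, arr s2 aNXT i = w & 0 < fl s2 (posn s2 i) w.
  have [[nV f0]|[w nw fw]] := nxt2 i; [left | right].
    by split=> // w; have := f0 w; rewrite pos1 pos2 fl2 /fl arr1.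
  by exists w => //; move: fw; rewrite pos1 pos2 fl2 /fl arr1.
have st2 : advance_state s2 0 0 s2.
  split=> // [v|i|]; rewrite ?/pot ?arr2 //; first exact: potE.
  apply: advance_init => // v; rewrite arr2 // cod2; exact: occ.
have [bs3 pot3 lt_pos3 _ inv3] := advance_spec inj2 tgt2 nxtP2 st2.
have fr3 : frame advance s2 (run advance s2) by apply: run_frame.
set s3 := run advance s2 in bs3 pot3 lt_pos3 inv3 fr3 *.
clearbody s3 s2 s1.
have fs := advance_flow_step nxtP2 phi_lt inv3.
have [_ _ _ bB _] := bs; have [_ _ _ bB1 _] := bs1; have [_ _ _ bB2 _] := bs2.
have ram3 j : j < var s rB -> ram s3 j = ram s1 j.
  by move=> lt_j; rewrite (frame_ram fr3) ?(frame_ram fr2) // -?bB1 -?bB2 bB.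
split.
- split=> // [|||u w].
  + exact: ai_inj inv3.
  + exact: ai_occ inv3.
  + exact: ai_bal inv3.
  + by move=> fw; apply: tgt2; apply: leq_trans fw (ai_flow inv3 _ _).
- case: fs => mv inj3 le_f blk; split=> // [i|u w|i w].
  + by have := mv i; rewrite !pos2 fl2.
  + by have := le_f u w; rewrite fl2.
  + move=> eq_i fw; have [||j] := blk i w; rewrite ?pos2 ?fl2 // => fj.
    by exists j.
- by move=> i; rewrite ram3; [rewrite rec1 posnE | apply: record_addr_lt].
- by move=> j lt_j ne_j; rewrite ram3 // rec2.
Qed.

(** Written exactly as [run] unfolds the loop, so that the state at each time of the schedule can be
    named. *)
Definition state_at s k := iter k (bump_run rk (run time_step)) (setv rk 0 s).

Lemma simulate_spec s : sim_inv s ->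
  [/\ base (run simulate s),
      forall k, k <= V + V -> sim_inv (state_at s k),
      forall k, k < V + V -> flow_step (@fl V (state_at s k)) (@fl V (state_at s k.+1))
        (posn (state_at s k)) (posn (state_at s k.+1)) &
      forall (i : 'I_n) k, k < V + V ->
        ram (run simulate s) (record_addr i k) = posn (state_at s k) i].
Proof.
move=> inv; have bs := sm_base inv; have [_ _ bW _ _] := bs.
pose I k s' := [/\ s' = state_at s k, sim_inv s' &
  forall (i : 'I_n) k', k' < k -> ram s' (record_addr i k') = posn (state_at s k') i].
have h0 : I 0 (setv rk 0 s) by split=> //; apply: sim_inv_setv.
have hS k s' : k < var s rW -> frame (For rk rW time_step) s s' -> var s' rk = k ->
    I k s' -> I k.+1 (setv rk k.+1 (run time_step s')).
  move=> lt_k fr eq_k [eq_s' inv' rec']; rewrite bW in lt_k.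
  have [inv2 _ rec1 rec2] := time_step_spec inv' eq_k lt_k.
  split.
  + rewrite /state_at iterS -/(state_at s k) -eq_s' /bump_run.
    by rewrite var_mods // eq_k.
  + exact: sim_inv_setv.
  + move=> i k'; rewrite ltnS leq_eqVlt => /predU1P[->|lt_k'] /=.
      by rewrite rec1 eq_s'.
    have lt_k2 : k' < V + V by apply: ltn_trans lt_k' lt_k.
    rewrite rec2 ?rec' //; first exact: record_addr_lt (sm_base inv') _ _.
    by move=> j; apply/eqP => /(record_addr_inj lt_k2 lt_k)[_]; lia.
have simk k : k <= V + V -> I k (state_at s k) /\ var (state_at s k) rk = k.
  by move=> le_k; have [|] := @iter_next I rk rW time_step s isT h0 hS k; rewrite ?bW.
have runW : run simulate s = state_at s (V + V) by rewrite /simulate run_iter bW.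
rewrite runW; split.
- by have [[_ /sm_base]] := simk _ (leqnn _).
- by move=> k /simk[[]].
- move=> k lt_k; have [[_ inv' _] eq_k] := simk k (ltnW lt_k).
  have [_ fs _ _] := time_step_spec inv' eq_k lt_k.
  rewrite /state_at iterS -/(state_at s k) /bump_run.
  by case: fs => h1 h2 h3 h4; split.
- by move=> i k lt_k; have [[_ _ rec'] _] := simk _ (leqnn (V + V)); apply: rec'.
Qed.

End Simulate.

Lemma nth_allpairs_idx (S T R : Type) (f : S -> T -> R) x0 y0 z0 s t i j :
  i < size s -> j < size t ->
  nth z0 [seq f x y | x <- s, y <- t] (i * size t + j) = f (nth x0 s i) (nth y0 t j).
Proof.
move=> lt_i lt_j; elim: s i lt_i => // x s IH [_|i lt_i].
  by rewrite mul0n add0n /= nth_cat size_map lt_j (nth_map y0).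
rewrite /= nth_cat size_map mulSn -addnA ltnNge leq_addr /= addKn.
exact: IH.
Qed.

(** * Loading the input and writing the goals *)

Section Load.
Variables (V n : nat) (e : rel 'I_V) (xI xG : 'I_n -> 'I_V).
Hypothesis inst : fcg_instance e xI xG.

Let cells := input_cells e xI xG.
Let init := MkStore (fun=> 0) (nth 0 cells).

Lemma size_input_cells : size cells = 2 + (V * V + (n + n)).
Proof. by rewrite !size_cat size_allpairs !size_enum_ord 2!size_map !size_enum_ord. Qed.

Lemma nth_cells2 j : nth 0 cells (2 + j) =
  nth 0 ([seq (e u v : nat) | u <- enum 'I_V, v <- enum 'I_V]
    ++ [seq (xI i : nat) | i <- enum 'I_n] ++ [seq (xG i : nat) | i <- enum 'I_n]) j.
Proof. by []. Qed.

Lemma input_edge (u w : 'I_V) : nth 0 cells (2 + (u * V + w)) = e u w.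
Proof.
have lt_uw := idx_lt u w.
rewrite nth_cells2 nth_cat.
rewrite size_allpairs !size_enum_ord lt_uw.
have := @nth_allpairs_idx _ _ _ (fun u v : 'I_V => e u v : nat) u w 0 (enum 'I_V) (enum 'I_V) u w.
rewrite !size_enum_ord !ltn_ord => -> //.
by rewrite !nth_ord_enum.
Qed.

Lemma input_start (i : 'I_n) : nth 0 cells (2 + (V * V + i)) = xI i.
Proof.
rewrite nth_cells2 nth_cat.
rewrite size_allpairs !size_enum_ord ltnNge leq_addr /= addKn nth_cat size_map size_enum_ord.
by rewrite ltn_ord (nth_map i) ?size_enum_ord // nth_ord_enum.
Qed.

Lemma input_goal (i : 'I_n) : nth 0 cells (2 + (V * V + (n + i))) = xG i.
Proof.
rewrite nth_cells2 nth_cat.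
rewrite size_allpairs !size_enum_ord ltnNge leq_addr /= addKn nth_cat size_map size_enum_ord.
by rewrite ltnNge leq_addr /= addKn (nth_map i) ?size_enum_ord // nth_ord_enum.
Qed.

Lemma load_sizes_spec : let s := run load_sizes init in
  [/\ var s rV = V, var s rn = n, var s rq = V * V /\ var s rr = 0, var s rW = V + V &
      2 + (V * V + V * V + (V * V + V * V)) = var s rB /\ ram s = nth 0 cells].
Proof.
pose s1 := setv rn n (setv rV V init).
pose s2 := run (For rv rV (Assign rq (Plus (Var rq) (Var rV)))) s1.
have [q2 ram2] : var s2 rq = V * V /\ ram s2 = nth 0 cells.
  pose I k s := var s rq = k * V /\ ram s = nth 0 cells.
  apply: (for_rule (I := I)) => // k s _ fr _ [q_s ram_s].
  by split=> //=; rewrite q_s (frame_var fr) //= mulSn addnC.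
have fr : frame (For rv rV (Assign rq (Plus (Var rq) (Var rV)))) s1 s2 by apply: run_frame.
have -> : run load_sizes init = setv rB
    (2 + (var s2 rq + var s2 rq + (var s2 rq + var s2 rq))) (setv rW (var s2 rV + var s2 rV) s2).
  by [].
by rewrite /= q2 !(frame_var fr).
Qed.

Lemma load_rows_spec s : var s rV = V -> var s rn = n -> var s rW = V + V ->
  2 + (V * V + V * V + (V * V + V * V)) = var s rB -> var s rr = 0 ->
  base V n (run load_rows s).
Proof.
move=> sV sn sW sB sr.
have fr : frame load_rows s (run load_rows s) by apply: run_frame.
pose I k s' := var s' rr = k * V /\ forall u, u < k -> arr s' aROW u = u * V.
have [_ rows] : I (var s rV) (run load_rows s).
  apply: for_rule => // k s' lt_k fr' eq_k [r_s rows].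
  rewrite !runE; split=> [|u] /=.
    by rewrite r_s (frame_var fr') // sV mulSn addnC.
  rewrite !arr_setv // arr_put // eq_k r_s /= ltnS leq_eqVlt.
  by case: eqP => [->//|_ /= /rows].
by split; rewrite ?(frame_var fr) // => u lt_u; apply: rows; rewrite sV.
Qed.

Definition marked (g : 'I_n -> 'I_V) k (v : 'I_V) : bool :=
  [exists i : 'I_n, (i < k) && (g i == v)].

Lemma markedS g k (lt_k : k < n) v :
  marked g k.+1 v = (v == g (Ordinal lt_k)) || marked g k v.
Proof.
apply/existsP/orP => [[i /andP[/(ord_ltS lt_k)[->|lt_i] /eqP eq_v]]|].
- by left; rewrite eq_v.
- by right; apply/existsP; exists i; rewrite lt_i eq_v eqxx.
case=> [/eqP->|/existsP[i /andP[lt_i eq_v]]]; first by exists (Ordinal lt_k); rewrite /= leqnn eqxx.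
by exists i; rewrite eq_v andbT; apply: leqW.
Qed.

Lemma marked_codom g v : marked g n v = (v \in codom g).
Proof.
apply/existsP/codomP => [[i /andP[_ /eqP<-]]|[i ->]]; first by exists i.
by exists i; rewrite ltn_ord eqxx.
Qed.

Lemma load_agents_spec s : base V n s -> var s rq = V * V ->
  (forall i : 'I_n, ram s (2 + (V * V + i)) = xI i) ->
  (forall i : 'I_n, ram s (2 + (V * V + (n + i))) = xG i) ->
  (forall a i, a < 16 -> a != aROW -> arr s a i = 0) ->
  let s' := run load_agents s in
  [/\ forall i : 'I_n, arr s' aPOS i = xI i,
      forall v : 'I_V, arr s' aUS v = (v \in codom xI),
      forall v : 'I_V, arr s' aOCC v = (v \in codom xI) &
      forall v : 'I_V, arr s' aUG v = (v \in codom xG)].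
Proof.
move=> bs sq ramI ramG arr0; have [_ bn _ bB _] := bs.
pose I k s' := [/\ forall i : 'I_n, i < k -> arr s' aPOS i = xI i,
  forall v : 'I_V, arr s' aUS v = marked xI k v,
  forall v : 'I_V, arr s' aOCC v = marked xI k v &
  forall v : 'I_V, arr s' aUG v = marked xG k v].
suff : I (var s rn) (run load_agents s).
  rewrite bn => -[h1 h2 h3 h4]; split=> [i|v|v|v]; rewrite -?marked_codom //.
  exact: h1.
have none g v : marked g 0 v = false by apply/existsP => -[].
apply: for_rule => //.
  by split=> // v; rewrite arr_setv // arr0 // none.
move=> k s' lt_k fr eq_k [h1 h2 h3 h4]; rewrite bn in lt_k.
pose i := Ordinal lt_k.
have nV : n <= V := agents_le inst.
have V_gt0 : 0 < V by apply: leq_trans nV; exact: leq_ltn_trans (leq0n k) lt_k.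
have lt_B1 : 2 + (V * V + k) < var s rB by rewrite -bB; nia.
have lt_B2 : 2 + (V * V + (n + k)) < var s rB by rewrite -bB; nia.
have r1 : ram s' (2 + (V * V + k)) = xI i by rewrite (frame_ram fr) // -(ramI i).
have r2 : ram s' (2 + (V * V + (n + k))) = xG i by rewrite (frame_ram fr) // -(ramG i).
have q' : var s' rq = V * V by rewrite (frame_var fr).
have n' : var s' rn = n by rewrite (frame_var fr).
rewrite !runE /= q' eq_k n' r1 r2; split=> [j|v|v|v]; rewrite arr_setv // !arr_put //= !arr_setv //.
- case: eqP => [eq_j _|ne]; first by congr (xI _ : nat); apply: val_inj.
  by rewrite ltnS leq_eqVlt => /predU1P[//|]; apply: h1.
- by rewrite markedS h2 -[_ == _ :> nat]/(v == xI i); case: eqP.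
- by rewrite markedS h3 -[_ == _ :> nat]/(v == xI i); case: eqP.
- by rewrite markedS h4 -[_ == _ :> nat]/(v == xG i); case: eqP.
Qed.

Lemma sum_codom (g : 'I_n -> 'I_V) : injective g -> \sum_v (v \in codom g) = n.
Proof.
by move=> inj; rewrite -[RHS](card_ord n) -(card_codom inj) -sum1_card [RHS]big_mkcond.
Qed.

Lemma load_spec : let s := run load_agents (run load_rows (run load_sizes init)) in
  phase_inv e xI xG 0 s /\
  [/\ forall i : 'I_n, arr s aPOS i = xI i &
      forall v : 'I_V, arr s aOCC v = (v \in codom xI)].
Proof.
cbv zeta; set s1 := run load_sizes init; set s2 := run load_rows s1.
set s3 := run load_agents s2.
have [sV sn [sq sr] sW [sB ram1]] := load_sizes_spec.
rewrite -/s1 in sV sn sq sr sW sB ram1.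
have bs2 : base V n s2 by apply: load_rows_spec.
have fr2 : frame load_rows s1 s2 by apply: run_frame.
have fr3 : frame load_agents s2 s3 by apply: run_frame.
have bs3 : base V n s3 by apply: (base_frame _ fr3 bs2).
have nV : n <= V := agents_le inst.
have n_gt0 : 0 < n := fcg_agents inst.
(* As n <= V, the base lies beyond the input, so the arrays start out within the zeros that follow
   it. *)
have arr1 a i : arr s1 a i = 0.
  by rewrite /arr /cell -sB ram1 nth_default // size_input_cells; nia.
have arr2 a i : a < 16 -> a != aROW -> arr s2 a i = 0.
  by move=> lt_a ne; rewrite (frame_arr fr2) // inE.
have ram2 j : j < 2 + (V * V + (n + n)) -> ram s2 j = nth 0 cells j.
  by move=> lt_j; rewrite (frame_ram fr2) ?ram1 // -sB; nia.
have q2 : var s2 rq = V * V by rewrite (frame_var fr2).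
have [||posE usE occE ugE] := load_agents_spec bs2 q2 _ _ arr2.
- by move=> i; rewrite ram2 ?input_start //; have := ltn_ord i; lia.
- by move=> i; rewrite ram2 ?input_goal //; have := ltn_ord i; lia.
rewrite -/s3 in posE usE occE ugE.
have zero a i : a \notin [:: aROW; aPOS; aUS; aOCC; aUG] -> a < 16 -> arr s3 a i = 0.
  rewrite !inE !negb_or => /and5P[n0 n1 n2 n3 n4] lt_a.
  by rewrite (frame_arr fr3) ?arr2 // !inE !negb_or n1 n2 n3 n4.
have pot0 v : pot s3 v = 0 by rewrite /pot zero.
have fl0 u w : fl s3 u w = 0 by rewrite /fl zero.
split; last by split.
split=> //.
- move=> u w; have [_ _ _ bB _] := bs2.
  have lt_uw := idx_lt u w.
  by rewrite (frame_ram fr3) // -?bB; [rewrite ram2 ?input_edge //; lia | lia].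
- by move=> u w _; rewrite !pot0.
- by move=> u w; rewrite fl0.
- by move=> v; rewrite usE leq_b1.
- by move=> v; rewrite ugE leq_b1.
- move=> v; rewrite usE ugE /outflow /inflow !big1 //.
  by rewrite !add0n !addn0 addnC.
- by exists (xI (Ordinal n_gt0)).
- by rewrite addn0 -[RHS](sum_codom (fcg_injI inst)); apply: eq_bigr => v _; rewrite usE.
- by rewrite addn0 -[RHS](sum_codom (fcg_injG inst)); apply: eq_bigr => v _; rewrite ugE.
Qed.

Lemma write_goals_spec s : base V n s ->
  let s' := run write_goals s in
  [/\ ram s' 0 = V + V - 1,
      forall i : 'I_n, ram s' (1 + i) = ram s (record_addr V n i (V + V - 1)) &
      forall j, 1 + n <= j -> ram s' j = ram s j].
Proof.
move=> bs; have [_ bn bW bB _] := bs.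
have nV : n <= V := agents_le inst.
have n_gt0 : 0 < n := fcg_agents inst.
pose s0 := out 0 (V + V - 1) s.
have ram0 j : ram s0 j = if j == 0 then V + V - 1 else ram s j.
  by rewrite /s0 ram_out // -bB.
have bs0 : base V n s0.
  have [h1 h2 h3 h4 h5] := bs.
  by split; rewrite /s0 ?var_out // => u lt_u; rewrite arr_out h5.
have [_ bn0 bW0 bB0 _] := bs0.
pose c := For ri rn
  (Out (Plus (Cst 1) (Var ri)) (Raw (record_cell (Minus (Var rW) (Cst 1))))).
have -> : run write_goals s = run c s0.
  by rewrite /write_goals !(runE.1) /= bW.
pose I k s' := [/\ ram s' 0 = V + V - 1,
  forall i : 'I_n, i < k -> ram s' (1 + i) = ram s (record_addr V n i (V + V - 1)) &
  forall j, 1 + n <= j -> ram s' j = ram s j].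
suff : I (var s0 rn) (run c s0).
  by rewrite bn0 => -[h1 h2 h3]; split=> // i; apply: h2.
apply: for_rule => //.
  split=> //= j.
  by rewrite ram0; case: eqP => // ->.
move=> k s' lt_k fr eq_k [h1 h2 h3]; rewrite bn0 in lt_k.
have bs' : base V n s' by apply: (base_frame _ fr bs0).
have [_ bn' bW' bB' row'] := bs'.
have lt_B : 1 + k < var s' rB by rewrite -bB'; nia.
rewrite !runE /= eq_k bn' bW' row' -/(record_addr V n k (V + V - 1)); last exact: leq_trans nV.
(* The recorded final position lies beyond the cells 0, ..., n, the only ones overwritten here. *)
rewrite h3; last by rewrite /record_addr; lia.
split=> [|i /(ord_ltS lt_k)[->|lt_i]|j le_j]; rewrite /= ram_out //.
- by rewrite eqxx.
- by case: eqP => [eq_i|_]; [lia | apply: h2].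
- by case: eqP => [eq_j|_]; [lia | apply: h3].
Qed.

End Load.

(** * Running time and conclusion *)

Lemma time_load_sizes V n (e : rel 'I_V) (xI xG : 'I_n -> 'I_V) :
  time load_sizes (MkStore (fun=> 0) (nth 0 (input_cells e xI xG))) = 8 * V + 23.
Proof.
rewrite /load_sizes /=; under eq_bigr do rewrite addnE /=.
rewrite sum_nat_const card_ord; lia.
Qed.

(** The leading terms come from the n searches and from the 2 V time steps, each of which runs over
    n V pairs twice; the other monomials are absorbed since n and V are positive. The factor 3000 is
    a round bound for the sum of the coefficients. *)
Lemma main_loop_cost V n : 0 < n <= V -> cost (sizes_env V n) main_loop <= 3000 * (n * V ^ 2).
Proof.
move=> /andP[n_gt0 le_n].
have h1 : 1 <= n * V * V by nia.
have h2 : n <= n * V * V by nia.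
have h3 : V <= n * V * V by nia.
have h4 : n * V <= n * V * V by nia.
have h5 : V * V <= n * V * V by nia.
cbv -[addn muln expn leq]; lia.
Qed.

Section Final.
Variables (V n : nat) (e : rel 'I_V) (xI xG : 'I_n -> 'I_V).
Hypothesis inst : fcg_instance e xI xG.

Let init := MkStore (fun=> 0) (nth 0 (input_cells e xI xG)).

Lemma algorithm_correct : exists (s : {perm 'I_V}) (P : 'I_n -> nat -> 'I_V),
  let fin := run algorithm init in
  [/\ forall i : 'I_n, ram fin (1 + i) = s (xG i),
      forall (i : 'I_n) k,
        ram fin (1 + n + i * (ram fin 0).+1 + minn k (ram fin 0)) = P i k,
      distance_optimal e xI xG s P &
      exists2 c, convergence_time xG s P c & c <= n + max_dist e xI xG - 1].
Proof.
have [inv0 [posE occE]] := load_spec inst.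
rewrite -/init in inv0 posE occE.
set s3 := run load_agents _ in inv0 posE occE.
have fr4 : frame optimise s3 (run optimise s3) by apply: run_frame.
have := optimise_spec inst inv0.
have -> : run algorithm init = run write_goals (run simulate (run optimise s3)) by [].
set s4 := run optimise s3 in fr4 *; clearbody s4 s3.
case=> [bs4 _ lip tgt _ _ cons _ [v0 pot0] sum_us sum_ug].
have n_gt0 : 0 < n := fcg_agents inst.
have nV : n <= V := agents_le inst.
have us0 (v : 'I_V) : arr s4 aUS v = 0.
  have : \sum_(v : 'I_V) arr s4 aUS v == 0 by rewrite -(eqn_add2r n) sum_us.
  by rewrite sum_nat_eq0 => /forallP/(_ v)/eqP.
have ug0 (v : 'I_V) : arr s4 aUG v = 0.
  have : \sum_(v : 'I_V) arr s4 aUG v == 0 by rewrite -(eqn_add2r n) sum_ug.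
  by rewrite sum_nat_eq0 => /forallP/(_ v)/eqP.
(* Some vertex has potential 0, and all distances are below V. *)
have phi_lt (v : 'I_V) : pot s4 v < V.
  have conn := fcg_connected inst v v0.
  have := lip_dist conn lip; rewrite pot0 add0n => le_v.
  by have [p [_ _ _]] := dist_path conn; rewrite card_ord; apply: leq_ltn_trans.
have pos4 (i : 'I_n) : arr s4 aPOS i = xI i by rewrite (frame_arr fr4).
have posn4 i : posn xI s4 i = xI i.
  by apply: val_inj; rewrite /= -posnE pos4.
have cod4 v : (v \in codom (posn xI s4)) = (v \in codom xI).
  by congr (_ \in _); apply: eq_codom.
have sim4 : sim_inv e xI xG (pot s4) s4.
  split=> // [i|i j|v|v].
  - by rewrite pos4.
  - by rewrite !posn4; apply: (fcg_injI inst).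
  - by rewrite cod4 (frame_arr fr4) // occE; case: (_ \in _).
  - by rewrite cod4; have := cons v; rewrite us0 ug0 !addn0.
have [bs5 inv_at step_at rec_at] := simulate_spec inst phi_lt sim4.
have [ram0 goals keep] := write_goals_spec inst bs5.
set s5 := run simulate s4 in bs5 rec_at ram0 goals keep *.
pose pos k := posn xI (state_at s4 k).
pose f k := @fl V (state_at s4 k).
(* The last recorded time; it is late enough for all agents to have stopped because n <= V. *)
pose K := V + V - 1.
have K_lt : K < V + V by rewrite /K; lia.
have bal k : k <= K -> balanced xG (f k) (pos k).
  by move=> le_k; apply: sm_bal (inv_at k _); lia.
have stp k : k < K -> flow_step (f k) (f k.+1) (pos k) (pos k.+1).
  by move=> lt_k; apply: step_at; lia.
have K_large : #|'I_V| + n <= K.+1 by rewrite card_ord /K; lia.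
have phi_lt' (v : 'I_V) : pot s4 v < #|'I_V| by rewrite card_ord.
have pos0 : pos 0 =1 xI by exact: posn4.
have tgt0 : tight e (pot s4) (f 0) by exact: tgt.
have [s [sG opt conv]] := schedule_optimal inst lip tgt0 phi_lt' pos0 bal stp K_large.
have addrE i k : 1 + n + i * K.+1 + k = record_addr V n i k.
  have -> : K.+1 = V + V by rewrite /K; lia.
  by rewrite mulnDr.
exists s, (fun i k => pos (minn k K) i); split=> // [i|i k].
  by rewrite goals rec_at // sG.
rewrite ram0 -/K addrE keep; last by rewrite /record_addr -!addnA leq_addr.
by rewrite rec_at //; apply: leq_ltn_trans K_lt; apply: geq_minr.
Qed.

Lemma algorithm_time : time algorithm init <= 4000 * (n * V ^ 2).
Proof.
have n_gt0 : 0 < n := fcg_agents inst.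
have nV : n <= V := agents_le inst.
have [sV sn _ sW _] := load_sizes_spec e xI xG.
have -> : time algorithm init =
  time load_sizes init + time main_loop (run load_sizes init) by [].
rewrite time_load_sizes.
have : time main_loop (run load_sizes init) <= cost (sizes_env V n) main_loop.
  apply: time_cost => // r hr.
  (* Every loop limit is one of the three size registers, whose values [load_sizes] has fixed. *)
  have : r \in [:: rV; rn; rW] by apply: (allP (_ : all (mem [:: rV; rn; rW]) (lims main_loop))).
  by rewrite !inE => /or3P[] /eqP->.
have := @main_loop_cost V n; rewrite n_gt0 nV => /(_ isT).
have : V <= n * V ^ 2 by rewrite (expnS V 1) expn1; nia.
lia.
Qed.

End Final.

Theorem mainTheorem2 :
  exists (prog : program) (C : nat),
  forall (V n : nat) (e : rel 'I_V) (xI xG : 'I_n -> 'I_V),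
    fcg_instance e xI xG ->
    exists (t : nat) (st : state) (s : {perm 'I_V}) (P : 'I_n -> nat -> 'I_V),
      [/\ exec prog (init_state e xI xG) t st,
          t <= C * (n * V ^ 2),
          output_is xG st s P,
          distance_optimal e xI xG s P &
          exists2 c : nat, convergence_time xG s P c
                         & c <= n + max_dist e xI xG - 1].
Proof.
exists (code algorithm 0), 4000 => V n e xI xG inst.
set s0 := MkStore (fun=> 0) (nth 0 (input_cells e xI xG)).
have [s [P [goals paths opt conv]]] := algorithm_correct inst.
rewrite -/s0 in goals paths.
have at0 : instr_at (code algorithm 0) 0 (code algorithm 0) by [].
have ag0 : agree s0 (fun=> 0) by [].
have [regs ag st] := code_steps algorithm_ok ag0 at0.
(* Register 0 is never assigned, so the output block starts at address 0. *)
have regs0 : regs 0 = 0 by rewrite ag // var_mods.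
exists (time algorithm s0), (State (0 + csize algorithm) regs (ram (run algorithm s0))), s, P.
split=> //.
- apply: exec_steps st _.
  (* Past its last instruction the program fetches the default [Halt]. *)
  by rewrite /step /fetch nth_default // size_code.
- exact: algorithm_time.
- by rewrite /output_is /= regs0; split=> [i|i k]; [apply: goals | apply: paths].
Qed.
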